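(* Let $M$ be a finitely generated commutative monoid of rank $r$, and let $M\curvearrowright X$ be a bounded-to-one Borel action on a standard Borel space $X$. Then the action has Borel asymptotic dimension at most $(3^{r+1}-3)/2$, i.e. $\operatorname{asdim}_B(M\curvearrowright X)\le (3^{r+1}-3)/2$.
   Context: Monoids are commutative with identity, written additively; the action is written $mx$, so $0x=x$ and $(m+n)x=m(nx)$. The action is Borel if each map $x\mapsto mx$ on $X$ is Borel. It is bounded-to-one if for each $m\in M$ there is a finite $k_m$ such that every fiber of $x\mapsto mx$ has at most $k_m$ elements. No freeness is assumed. The rank of $M$ is $\operatorname{rk}(M)=\dim_{\mathbb Q}(M^{\mathrm{gp}}\otimes_{\mathbb Z}\mathbb Q)$, where $M^{\mathrm{gp}}$ is the group completion of $M$. For a finite generating set $S$ of $M$, the (undirected) Schreier graph on $X$ has an edge between $x$ and $sx$ for every $x\in X$, $s\in S$, with loops discarded; $d_X$ is its path metric, an extended metric with values in $\mathbb N\cup\{\infty\}$ (distinct components at distance $\infty$). The Borel asymptotic dimension satisfies $\operatorname{asdim}_B(M\curvearrowright X)\le n$ if for every integer $s\ge1$ there is a Borel equivalence relation $E$ on $X$ whose classes have uniformly bounded $d_X$-diameter and such that each closed ball $B_X(x,s)=\{y:d_X(x,y)\le s\}$ meets at most $n+1$ classes of $E$. This does not depend on the choice of the finite generating set. *)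

(* Defs.v *)
From HB Require Import structures.
From mathcomp Require Import all_boot all_order all_algebra generic_quotient.
From mathcomp Require Import all_classical all_reals all_analysis.

Set Implicit Arguments.
Unset Strict Implicit.
Unset Printing Implicit Defensive.

Import Order.TTheory GRing.Theory Num.Theory.

Local Open Scope classical_set_scope.
Local Open Scope ring_scope.
Local Open Scope quotient_scope.
Local Open Scope card_scope.

Section GroupCompletion.
Variable M : nmodType.

(* The pair (a, b) stands for the formal difference a - b; the witness k is
   needed because M need not be cancellative. *)
Definition gpdiff_eq (p q : M * M) : bool :=
  `[< exists k : M, p.1 + q.2 + k = q.1 + p.2 + k >].

Lemma gpdiff_eq_refl : reflexive gpdiff_eq.
Proof. by move=> p; apply/asboolP; exists 0. Qed.

Lemma gpdiff_eq_sym : symmetric gpdiff_eq.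
Proof. by move=> p q; apply/asboolP/asboolP => -[k /esym kE]; exists k. Qed.

Lemma gpdiff_eq_trans : transitive gpdiff_eq.
Proof.
move=> q p s /asboolP[k pq] /asboolP[l qs]; apply/asboolP.
exists (q.1 + q.2 + k + l); rewrite !addrA.
rewrite [LHS](ACl ((1*4*5)*(3*2*6))) /= pq qs !addrA.
by rewrite [LHS](ACl (4*2*1*5*3*6)).
Qed.

Canonical gpdiff_eq_equiv :=
  EquivRel gpdiff_eq gpdiff_eq_refl gpdiff_eq_sym gpdiff_eq_trans.

Definition gpcompl := {eq_quot gpdiff_eq}.

HB.instance Definition _ := Choice.on gpcompl.

Definition gp_pi (p : M * M) : gpcompl := \pi p.
Definition gp_add (x y : gpcompl) : gpcompl := gp_pi (repr x + repr y).
Definition gp_opp (x : gpcompl) : gpcompl := gp_pi ((repr x).2, (repr x).1).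

Lemma gp_piP p q :
  gp_pi p = gp_pi q <-> exists k : M, p.1 + q.2 + k = q.1 + p.2 + k.
Proof. by split=> [/eqquotP/asboolP|pq]; last exact/eqquotP/asboolP. Qed.

Lemma gp_piK x : gp_pi (repr x) = x. Proof. exact: reprK. Qed.

Lemma gp_repr p : exists k : M,
  (repr (gp_pi p)).1 + p.2 + k = p.1 + (repr (gp_pi p)).2 + k.
Proof. exact/gp_piP/gp_piK. Qed.

Lemma gp_addE p q : gp_add (gp_pi p) (gp_pi q) = gp_pi (p + q).
Proof.
have [k pk] := gp_repr p; have [l ql] := gp_repr q.
apply/gp_piP; exists (k + l) => /=; rewrite !addrA.
rewrite [LHS](ACl ((1*3*5)*(2*4*6))) /= pk ql !addrA.
by rewrite [LHS](ACl (1*4*2*5*3*6)).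
Qed.

Lemma gp_oppE p : gp_opp (gp_pi p) = gp_pi (p.2, p.1).
Proof.
have [k pk] := gp_repr p; apply/gp_piP; exists k => /=.
by rewrite [LHS](ACl (2*1*3)) [RHS](ACl (2*1*3)) /= pk.
Qed.

Fact gp_addA : associative gp_add.
Proof.
move=> x y z; rewrite -(gp_piK x) -(gp_piK y) -(gp_piK z).
by rewrite !gp_addE addrA.
Qed.

Fact gp_addC : commutative gp_add.
Proof. by move=> x y; rewrite -(gp_piK x) -(gp_piK y) !gp_addE addrC. Qed.

Fact gp_add0 : left_id (gp_pi 0) gp_add.
Proof. by move=> x; rewrite -(gp_piK x) gp_addE add0r. Qed.

Fact gp_addN : left_inverse (gp_pi 0) gp_opp gp_add.
Proof.
move=> x; rewrite -(gp_piK x) gp_oppE gp_addE; apply/gp_piP; exists 0 => /=.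
by rewrite !addr0 !add0r addrC.
Qed.

HB.instance Definition _ :=
  GRing.isZmodule.Build gpcompl gp_addA gp_addC gp_add0 gp_addN.
End GroupCompletion.

(* Elements are formal sums of elementary tensors, represented by sequences and
   identified by the smallest congruence making concatenation commutative and
   the elementary tensor biadditive. *)
Section TensorProduct.
Variables A B : zmodType.

Inductive tensor_cong : seq (A * B) -> seq (A * B) -> Prop :=
| tensor_refl s : tensor_cong s s
| tensor_sym s t : tensor_cong s t -> tensor_cong t s
| tensor_trans s t u : tensor_cong s t -> tensor_cong t u -> tensor_cong s u
| tensor_cat s s' t t' :
    tensor_cong s s' -> tensor_cong t t' -> tensor_cong (s ++ t) (s' ++ t')
| tensor_catC s t : tensor_cong (s ++ t) (t ++ s)
| tensor_addl a a' b : tensor_cong [:: (a + a', b)] [:: (a, b); (a', b)]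
| tensor_addr a b b' : tensor_cong [:: (a, b + b')] [:: (a, b); (a, b')]
| tensor_0l b : tensor_cong [:: (0, b)] [::]
| tensor_0r a : tensor_cong [:: (a, 0)] [::].

Definition tensor_eq (s t : seq (A * B)) : bool := `[< tensor_cong s t >].

Lemma tensor_eq_refl : reflexive tensor_eq.
Proof. by move=> s; apply/asboolP; constructor. Qed.

Lemma tensor_eq_sym : symmetric tensor_eq.
Proof. by move=> s t; apply/asboolP/asboolP; apply: tensor_sym. Qed.

Lemma tensor_eq_trans : transitive tensor_eq.
Proof.
move=> t s u /asboolP st /asboolP tu; apply/asboolP; exact: tensor_trans tu.
Qed.

Canonical tensor_eq_equiv :=
  EquivRel tensor_eq tensor_eq_refl tensor_eq_sym tensor_eq_trans.

Definition tensor := {eq_quot tensor_eq}.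

HB.instance Definition _ := Choice.on tensor.

Definition tensor_pi (s : seq (A * B)) : tensor := \pi s.
Definition tensor_add (x y : tensor) : tensor := tensor_pi (repr x ++ repr y).
Definition tensor_opp (x : tensor) : tensor :=
  tensor_pi [seq (- p.1, p.2) | p <- repr x].

Lemma tensor_piP s t : tensor_pi s = tensor_pi t <-> tensor_cong s t.
Proof. by split=> [/eqquotP/asboolP|st]; last exact/eqquotP/asboolP. Qed.

Lemma tensor_piK x : tensor_pi (repr x) = x. Proof. exact: reprK. Qed.

Lemma tensor_repr s : tensor_cong (repr (tensor_pi s)) s.
Proof. exact/tensor_piP/tensor_piK. Qed.

Lemma tensor_addE s t :
  tensor_add (tensor_pi s) (tensor_pi t) = tensor_pi (s ++ t).
Proof. by apply/tensor_piP/tensor_cat; apply: tensor_repr. Qed.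

Lemma tensor_oppE s :
  tensor_opp (tensor_pi s) = tensor_pi [seq (- p.1, p.2) | p <- s].
Proof.
apply/tensor_piP; move: (tensor_repr s); move: (repr _) => t; elim=> {s t}; try by constructor.
- by move=> s t u _ st _ tu; apply: tensor_trans tu.
- by move=> s s' t t' _ ss' _ tt'; rewrite !map_cat; apply: tensor_cat.
- by move=> s t; rewrite !map_cat; apply: tensor_catC.
- by move=> a a' b /=; rewrite opprD; apply: tensor_addl.
- by move=> b /=; rewrite oppr0; apply: tensor_0l.
Qed.

Fact tensor_addA : associative tensor_add.
Proof.
move=> x y z; rewrite -(tensor_piK x) -(tensor_piK y) -(tensor_piK z).
by rewrite !tensor_addE catA.
Qed.

Fact tensor_addC : commutative tensor_add.
Proof.
move=> x y; rewrite -(tensor_piK x) -(tensor_piK y) !tensor_addE.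
exact/tensor_piP/tensor_catC.
Qed.

Fact tensor_add0 : left_id (tensor_pi [::]) tensor_add.
Proof. by move=> x; rewrite -(tensor_piK x) tensor_addE. Qed.

Fact tensor_addN : left_inverse (tensor_pi [::]) tensor_opp tensor_add.
Proof.
move=> x; rewrite -(tensor_piK x) tensor_oppE.
elim: (repr x) => [|[a b] s IHs] /=; first by rewrite tensor_add0.
have -> t : tensor_pi ((- a, b) :: t) =
    tensor_add (tensor_pi [:: (- a, b)]) (tensor_pi t) by rewrite tensor_addE.
have -> : tensor_pi ((a, b) :: s) =
    tensor_add (tensor_pi s) (tensor_pi [:: (a, b)]).
  by rewrite tensor_addC tensor_addE.
rewrite -tensor_addA [X in tensor_add _ X]tensor_addA IHs tensor_add0.
rewrite tensor_addE; apply/tensor_piP.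
apply: tensor_trans (tensor_sym (tensor_addl (- a) a b)) _.
by rewrite addNr; apply: tensor_0l.
Qed.

HB.instance Definition _ := GRing.isZmodule.Build tensor
  tensor_addA tensor_addC tensor_add0 tensor_addN.
End TensorProduct.

Section TensorScaling.
Variables (K : nzRingType) (A : zmodType) (B : lmodType K).

Definition tensor_scale (c : K) (x : tensor A B) : tensor A B :=
  tensor_pi [seq (p.1, c *: p.2) | p <- repr x].

Lemma tensor_scaleE c s :
  tensor_scale c (tensor_pi s) = tensor_pi [seq (p.1, c *: p.2) | p <- s].
Proof.
apply/tensor_piP; move: (tensor_repr s); move: (repr _) => t; elim=> {s t}; try by constructor.
- by move=> s t u _ st _ tu; apply: tensor_trans tu.
- by move=> s s' t t' _ ss' _ tt'; rewrite !map_cat; apply: tensor_cat.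
- by move=> s t; rewrite !map_cat; apply: tensor_catC.
- by move=> a b b' /=; rewrite scalerDr; apply: tensor_addr.
- by move=> a /=; rewrite scaler0; apply: tensor_0r.
Qed.

Fact tensor_scaleA c c' x :
  tensor_scale c (tensor_scale c' x) = tensor_scale (c * c') x.
Proof.
rewrite -(tensor_piK x) !tensor_scaleE -map_comp.
by congr tensor_pi; apply: eq_map => p /=; rewrite scalerA.
Qed.

Fact tensor_scale1 : left_id 1 tensor_scale.
Proof.
move=> x; rewrite -(tensor_piK x) tensor_scaleE; congr tensor_pi.
by rewrite -[RHS]map_id; apply: eq_map => -[a b] /=; rewrite scale1r.
Qed.

Fact tensor_scaleDr : right_distributive tensor_scale +%R.
Proof.
move=> c x y; rewrite -(tensor_piK x) -(tensor_piK y).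
by rewrite [X in tensor_scale c X]tensor_addE !tensor_scaleE map_cat -tensor_addE.
Qed.

Fact tensor_scaleDl x : {morph tensor_scale^~ x : c c' / c + c'}.
Proof.
move=> c c'; rewrite -(tensor_piK x) !tensor_scaleE.
rewrite [RHS]tensor_addE; apply/tensor_piP.
elim: (repr x) => [|[a b] s IHs] /=; first exact: tensor_refl.
rewrite scalerDl -cat1s.
apply: tensor_trans (tensor_cat (tensor_addr a (c *: b) (c' *: b)) IHs) _.
rewrite -cat1s -[_ :: (map _ _ ++ _)]cat1s /=.
apply: (tensor_cat (tensor_refl [:: (a, c *: b)])) => /=.
rewrite -[_ :: _ ++ _]cat1s catA -[X in tensor_cong _ (_ ++ X)]cat1s catA.
exact: tensor_cat (tensor_catC _ _) (tensor_refl _).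
Qed.

HB.instance Definition _ := GRing.Zmodule_isLmodule.Build K (tensor A B)
  tensor_scaleA tensor_scale1 tensor_scaleDr tensor_scaleDl.
End TensorScaling.

(* M^gp (x) Q has dimension r over Q. For a finitely generated M exactly one r
   satisfies this. *)
Definition has_rank (M : nmodType) (r : nat) : Prop :=
  inhabited (Vector.axiom r (tensor (gpcompl M) rat^o)).

Definition generates (M : nmodType) (S : seq M) : Prop :=
  forall m : M, exists2 w : seq M, {subset w <= S} & m = \sum_(s <- w) s.

Definition monoid_action (M : nmodType) (X : Type) (act : M -> X -> X) : Prop :=
  (forall x, act 0 x = x) /\
  (forall m n x, act (m + n) x = act m (act n x)).

Definition borel_action d (M : nmodType) (X : measurableType d)
    (act : M -> X -> X) : Prop :=
  forall m, measurable_fun [set: X] (act m).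

Definition bounded_to_one (M : nmodType) (X : Type) (act : M -> X -> X) : Prop :=
  forall m, exists k : nat, forall y, [set x | act m x = y] #<= `I_k.

(* The library's pseudometric spaces need not be separated, hence the Hausdorff
   condition. *)
Definition polish (R : realType) (T : completePseudoMetricType R) : Prop :=
  hausdorff_space T /\ exists2 D : set T, countable D & dense D.

(* A measurableType is pointed, so X is nonempty. Since f is a bijection, every
   subset of X is the preimage of some A. *)
Definition standard_borel (R : realType) d (X : measurableType d) : Prop :=
  exists (T : completePseudoMetricType R) (f : X -> T),
    [/\ polish T, bijective f &
      forall A : set T, measurable (f @^-1` A) <-> <<s [set U | open U] >> A].

Section SchreierGraph.
Variables (R : realType) (M : nmodType) (S : seq M).

Definition schreier (X : eqType) (act : M -> X -> X) : rel X :=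
  [rel x y | (x != y) && has (fun s => (y == act s x) || (x == act s y)) S].

(* Extended path metric: the infimum of the empty set is +oo. *)
Definition schreier_dist (X : eqType) (act : M -> X -> X) (x y : X) : \bar R :=
  ereal_inf [set (size p)%:R%:E |
    p in [set p | path (schreier act) x p /\ last x p = y]].

Definition schreier_ball (X : eqType) (act : M -> X -> X) (x : X) (s : nat) :
  set X := [set y | (schreier_dist act x y <= s%:R%:E)%E].

(* Meant for S generating M; whether the bound holds does not depend on the
   choice of such an S. *)
Definition borel_asdim_le d (X : measurableType d) (act : M -> X -> X)
    (n : nat) : Prop :=
  forall s : nat, (1 <= s)%N -> exists E : rel X,
    [/\ equivalence_rel E,
        measurable [set p : X * X | E p.1 p.2],
        exists D : nat,
          forall x y, E x y -> (schreier_dist act x y <= D%:R%:E)%E &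
        forall x, [set [set z | E y z] | y in schreier_ball act x s]
          #<= `I_n.+1].
End SchreierGraph.

(* Main.v *)
From HB Require Import structures.
Require Import Defs.
From mathcomp Require Import all_boot all_order all_algebra.
From mathcomp Require Import all_classical all_reals all_analysis.
From mathcomp Require Import zify ring lra.

Set Implicit Arguments.
Unset Strict Implicit.
Unset Printing Implicit Defensive.

Import Order.TTheory GRing.Theory Num.Theory.

Local Open Scope classical_set_scope.
Local Open Scope ring_scope.
Local Open Scope card_scope.

(** Put n = 3^r.  The proof gives partitions of which every ball of radius s
    meets at most n classes, and n <= (3^(r+1) - 3)/2 + 1.

    Everything is read off from forward orbits.  If y is within distance s of
    x, then a y = b x for some words a, b of length at most s; adding to a a
    suitable complement gives p y = b' x, where p is the sum of all words of
    length at most s and b' runs through a finite set B depending on s only.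
    Hence it is enough to attach to every point t a center h(t) = m t, with m
    in a finite set of elements of M, so that h takes at most n values on a
    set B x; two points are equivalent when p sends them to points with the
    same center, after a further fixed translation z explained below.

    Tensoring with Q gives coordinates psi : M -> Q^r.  Let w bound |psi| in
    the sup norm on B.  As M^gp is finitely generated and the kernel of
    M^gp -> M^gp (x) Q is torsion, only finitely many elements of M^gp have
    coordinates at most 2w; translating them by a large u puts them into the
    image of M, which gives a finite set E of elements of M
    ([rank_coordinates]).  Suppose that a Borel set A, the markers, satisfies
    - every point t has a marker m t with m in E;
    - if g x and g' x are markers and psi g, psi g' differ by at most 2w, then
      g x and g' x have the same image under a fixed translation.
    Let h(t) be that translate of the first marker m t with m in E.  The
    markers used for the points of B x are of the form g x with psi g in a
    cube of side 6w.  Cutting the cube into 3^r cubes of side 2w, the markers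
    in each of the small cubes yield one and the same value of h.  Points of
    the orbit that happen to coincide do no harm, because the second condition
    only asserts that points are equal.  An equality in M^gp holds in M after
    adding some element; only finitely many equalities matter, and z is chosen
    to make all of them true at once.

    The markers are chosen greedily along a finite Borel coloring in which
    distinct points y, y' with m y = u y', m in E, have distinct colors.  The
    translation by -u being unavailable, the decision about a point is taken
    one translate by u further ahead at each stage ([marker]).

    The coloring ([finitely_colorable_span]) is where the action has to be
    bounded-to-one and X standard Borel.  The greedy recoloring of a countable
    coloring needs the set of points having a neighbour of a given color,
    which is an image of a Borel set and thus only analytic.  Novikov's
    separation theorem encloses these images in Borel sets without increasing
    the number of images that a point lies in ([image_envelopes]), and that
    number is all that the greedy algorithm uses. *)

(** * Deciding Borel sets along filters *)

(** A sequence of countable covers plays the role of a finer Polish topology: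
    row m is the m-th cover, and a filter containing a member of every row
    behaves like a Cauchy filter of that topology. *)
Definition row_cover (T : Type) (Q : nat -> nat -> set T) :=
  forall m x, exists i, Q m i x.

Definition meets_rows (T : Type) (Q : nat -> nat -> set T)
    (F : set_system T) :=
  forall m, exists i, F (Q m i).

Definition decides (T : Type) (F : set_system T) (x : T) (B : set T) :=
  (B x -> F B) /\ (~ B x -> F (~` B)).

Definition merge_rows (T : Type) (Q : nat -> nat -> nat -> set T) :
    nat -> nat -> set T :=
  fun m i => if unpickle m is Some (a, b) then Q a b i else setT.

Lemma merge_rows_cover (T : Type) (Q : nat -> nat -> nat -> set T) :
  (forall a, row_cover (Q a)) -> row_cover (merge_rows Q).
Proof.
move=> cQ m x; rewrite /merge_rows.
by case: (unpickle m) => [[a b]|]; [exact: cQ|exists 0%N].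
Qed.

Lemma meets_merge_rows (T : Type) (Q : nat -> nat -> nat -> set T) F a :
  meets_rows (merge_rows Q) F -> meets_rows (Q a) F.
Proof. by move=> mF b; have := mF (pickle (a, b)); rewrite /merge_rows pickleK. Qed.

Lemma countable_surj_nat (T : pointedType) (D : set T) :
  countable D -> exists d : nat -> T, forall x, D x -> exists n, d n = x.
Proof.
case/countable_injP => f fi.
exists (fun n => get (fun x => D x /\ f x = n)) => x Dx; exists (f x).
have [Dy fy] : (fun y => D y /\ f y = f x) (get (fun y => D y /\ f y = f x)).
  exact: (@getPex _ (fun y => D y /\ f y = f x) (ex_intro _ x (conj Dx erefl))).
by apply: fi; rewrite ?inE.
Qed.

Section Polish.
Variables (R : realType) (T : completePseudoMetricType R).

(** Says that B is clopen in the topology described by Q. *)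
Definition clarifies (Q : nat -> nat -> set T) (B : set T) :=
  forall F, ProperFilter F -> meets_rows Q F ->
    forall x, F --> x -> decides F x B.

(** The row consisting of the sets B i and the complement of their union is
    added to Q: if the limit x lies in no B i, then the filter contains the
    complement of every B i, so that the member of the new row in the filter
    can only be the complement of the union. *)
Lemma clarify_bigcup (Q : nat -> nat -> set T) (B : nat -> set T) :
  row_cover Q ->
  (forall F, ProperFilter F -> meets_rows Q F -> forall x, F --> x ->
    ((\bigcup_i B i) x -> F (\bigcup_i B i)) /\
    forall i, ~ B i x -> F (~` B i)) ->
  exists2 Q', row_cover Q' & clarifies Q' (\bigcup_i B i).
Proof.
move=> cQ hQ; set U := \bigcup_i B i.
pose Q' m i := if m is m'.+1 then Q m' i
  else if i is i'.+1 then B i' else ~` U.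
exists Q'.
  move=> [|m] x; last exact: cQ.
  have [[i _ Bix]|nUx] := pselect (U x); first by exists i.+1.
  by exists 0%N.
move=> F FF mF x Fx.
have [pU nB] := hQ F FF (fun m => mF m.+1) x Fx.
split=> // nUx; have [[|i] /= Fi] := mF 0%N; first exact: Fi.
have nBx : ~ B i x by move=> Bx; apply: nUx; exists i.
exfalso; apply: (@filter_not_empty _ F _).
by apply: filterS (filterI Fi (nB i nBx)) => y [].
Qed.

Lemma open_bigcup_closed (U : set T) : open U ->
  exists2 C : nat -> set T, (forall i, closed (C i)) & U = \bigcup_i C i.
Proof.
move=> oU.
exists (fun i => closure [set y | ball y i.+1%:R^-1 `<=` U]).
  by move=> i; exact: closed_closure.
apply/seteqP; split=> [y Uy|y [i _ cy]].
  have : nbhs y U by exact: open_nbhs_nbhs.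
  rewrite -nbhs_ballE => -[e /= e0 yU].
  have [k] := ltr_add_invr e0; rewrite add0r => ke.
  exists k => //; apply: subset_closure => z yz; apply: yU.
  exact: le_ball (ltW ke) _ yz.
have /cy[z [zU yz]] : nbhs y (ball y i.+1%:R^-1) by exact: nbhsx_ballx.
by apply: zU; exact: ball_sym.
Qed.

(** Every Borel set becomes clopen in a finer Polish topology.  Closed sets are
    handled through the complement of an open set, which is a countable union
    of closed sets. *)
Lemma borel_clarified (B : set T) : <<s [set U | open U] >> B ->
  exists2 Q, row_cover Q & clarifies Q B.
Proof.
move: B; apply: smallest_sub.
  split=> /=.
  - exists (fun _ _ => setT); first by move=> m x; exists 0%N.
    move=> F FF _ x _; split=> // _.
    by rewrite setC0; exact: filterT.
  - move=> A [Q cQ hQ]; exists Q => // F FF mF x Fx.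
    have [h1 h2] := hQ F FF mF x Fx; rewrite setTD.
    split=> [|nnAx]; first exact: h2.
    by rewrite setCK; apply: h1; exact: contrapT.
  - move=> B hB.
    have /choice[Q hQ] : forall i, exists Q, row_cover Q /\ clarifies Q (B i).
      by move=> i; have [Q] := hB i; exists Q.
    apply: (@clarify_bigcup (merge_rows Q)).
      by apply: merge_rows_cover => i; have [] := hQ i.
    move=> F FF mF x Fx.
    have dB i : decides F x (B i).
      by apply: (hQ i).2 => //; exact: meets_merge_rows.
    split=> [[i _ Bx]|i]; last exact: (dB i).2.
    by apply: filterS ((dB i).1 Bx) => y; exists i.
move=> U /= oU; have [C cC UE] := open_bigcup_closed oU; rewrite UE.
apply: (@clarify_bigcup (fun _ _ => setT)); first by move=> m x; exists 0%N.
move=> F FF _ x Fx; rewrite -UE; split=> [Ux|i nCx].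
  by apply: (Fx U); exact: open_nbhs_nbhs.
by apply: (Fx (~` C i)); apply: open_nbhs_nbhs; split=> //; exact: closed_openC.
Qed.

End Polish.

Section StandardBorel.
Variables (R : realType) (d : measure_display) (X : measurableType d).
Hypothesis stdX : standard_borel R X.

(** Interiors of the balls of radius 1/(k+1) around a countable dense set; the
    balls themselves need not be open. *)
Lemma separating_family : exists b : nat -> set X,
  (forall n, measurable (b n)) /\
  forall x y, x <> y -> exists n, (b n x /\ ~ b n y) \/ (b n y /\ ~ b n x).
Proof.
have [T [f [[hT [D cD dD]] bf mf]]] := stdX.
have [t ht] := countable_surj_nat cD.
pose W (p : nat * nat) := interior (ball (t p.1) (p.2.+1%:R^-1 : R)).
exists (fun n => if unpickle n is Some p then f @^-1` (W p) else set0).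
split=> [n|x y xy].
  case: (unpickle n) => [p|]; last exact: measurable0.
  by apply/mf; apply: sub_sigma_algebra; exact: open_interior.
suff [p [px py]] : exists p, W p (f x) /\ ~ W p (f y).
  by exists (pickle p); left; rewrite pickleK.
have fxy : f x <> f y by move=> /(bij_inj bf).
have [e e0 nxy] : exists2 e : R, 0 < e & ~ ball (f x) e (f y).
  apply: contrapT => h; apply: fxy; apply: hT => A B.
  rewrite -!nbhs_ballE => -[e /= e0 eA] [e' /= e'0 e'B].
  exists (f y); split; last by apply: e'B; exact: ballxx.
  by apply: eA; apply: contrapT => nb; apply: h; exists e.
have e20 : 0 < e / 2 by rewrite divr_gt0.
have [k] := ltr_add_invr e20; rewrite add0r => ke.
have k0 : 0 < (k.+1%:R^-1 / 2 : R) by rewrite divr_gt0.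
have [z [zb Dz]] : interior (ball (f x) (k.+1%:R^-1 / 2)) `&` D !=set0.
  apply: dD; last exact: open_interior.
  by exists (f x); apply: nbhsx_ballx.
have [n tn] := ht z Dz.
have {}zb : ball (f x) (k.+1%:R^-1 / 2) z by exact: interior_subset.
exists (n, k); split; rewrite /W /= tn.
  rewrite /interior /= -nbhs_ballE; exists (k.+1%:R^-1 / 2) => //= w xw.
  by apply: ball_splitr zb xw.
move=> /interior_subset zy; apply: nxy.
apply: (@ball_split _ _ z).
  apply: le_ball zb; rewrite ler_pM2r ?invr_gt0 //.
  by apply: le_trans (ltW ke) _; lra.
exact: le_ball (ltW ke) _ zy.
Qed.

(** The balls of radius 1/(k+1) around a dense sequence form a cover for each k,
    so that a filter meeting all rows is Cauchy and converges by completeness;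
    the other rows make the sets B n clopen. *)
Lemma deciding_rows (B : nat -> set X) : (forall n, measurable (B n)) ->
  exists2 Q : nat -> nat -> set X, row_cover Q &
    forall F, ProperFilter F -> meets_rows Q F ->
      exists x, forall n, decides F x (B n).
Proof.
move=> mB; have [T [f [[hT [D cD dD]] bf mf]]] := stdX.
have [t ht] := countable_surj_nat cD.
have [g fK gK] := bf.
have hB n : exists Q, row_cover Q /\ clarifies Q (g @^-1` B n).
  have [Q] : exists2 Q, row_cover Q & clarifies Q (g @^-1` B n); last by exists Q.
  apply: borel_clarified; apply/mf.
  by rewrite (_ : _ @^-1` _ = B n)//; apply/seteqP; split=> x /=; rewrite fK.
have [Q hQ] := choice hB.
pose balls m i := ball (t i) (m.+1%:R^-1 : R).
pose Q' a := if a is a'.+1 then Q a' else balls.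
exists (fun m i => f @^-1` (merge_rows Q' m i)).
  move=> m x; apply: merge_rows_cover => -[|a]; last by have [] := hQ a.
  move=> k y; have k0 : 0 < (k.+1%:R^-1 : R) by [].
  have [z [zb Dz]] : interior (ball y (k.+1%:R^-1 : R)) `&` D !=set0.
    apply: dD; last exact: open_interior.
    by exists y; apply: nbhsx_ballx.
  have [n tn] := ht z Dz; exists n; rewrite /= /balls tn; apply: ball_sym.
  exact: interior_subset.
move=> F FF mF.
have mF' : meets_rows (merge_rows Q') (f @ F) by [].
have : cvg (f @ F).
  apply: cauchy_cvg; apply: cauchy_exP => e e0.
  have [k] := ltr_add_invr e0; rewrite add0r => ke.
  have [i Fi] := meets_merge_rows 0 mF' k.
  by exists (t i); apply: filterS Fi; apply: le_ball; exact: ltW.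
move=> cF; exists (g (lim (f @ F))) => n.
have := (hQ n).2 (f @ F) _ (meets_merge_rows n.+1 mF') _ cF.
rewrite /decides /= /nbhs /= => -[h1 h2].
by split=> [/h1|/h2]; apply: filterS => x /=; rewrite fK.
Qed.

End StandardBorel.

(** * Separating images of Borel sets *)

Section MeasurablePredicates.
Variables (d : measure_display) (X : measurableType d).

Lemma mpred_forall (I : countType) (P : I -> X -> Prop) :
  (forall i, measurable [set x | P i x]) -> measurable [set x | forall i, P i x].
Proof.
move=> mP; rewrite (_ : mkset _ = ~` \bigcup_i ~` [set x | P i x]).
  by apply: measurableC; apply: countable_bigcupT_measurable => // i;
    exact: measurableC.
rewrite setC_bigcup; apply/seteqP; split=> [x Px i _|x Px i].
  by rewrite setCK; exact: Px.
by have := Px i Logic.I; rewrite setCK.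
Qed.

Lemma mpred_exists (I : countType) (P : I -> X -> Prop) :
  (forall i, measurable [set x | P i x]) -> measurable [set x | exists i, P i x].
Proof.
move=> mP; rewrite (_ : mkset _ = \bigcup_i [set x | P i x]).
  exact: countable_bigcupT_measurable.
by apply/seteqP; split=> [x [i Px]|x [i _ Px]]; exists i.
Qed.

Lemma mpred_const (p : Prop) : measurable [set _ : X | p].
Proof.
have [hp|hp] := pselect p.
  by rewrite (_ : mkset _ = setT)//; apply/seteqP; split.
by rewrite (_ : mkset _ = set0)//; apply/seteqP; split.
Qed.

Lemma mpred_and (P Q : X -> Prop) :
  measurable [set x | P x] -> measurable [set x | Q x] ->
  measurable [set x | P x /\ Q x].
Proof. exact: measurableI. Qed.

Lemma mpred_or (P Q : X -> Prop) :
  measurable [set x | P x] -> measurable [set x | Q x] ->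
  measurable [set x | P x \/ Q x].
Proof. exact: measurableU. Qed.

Lemma mpred_not (P : X -> Prop) :
  measurable [set x | P x] -> measurable [set x | ~ P x].
Proof. exact: measurableC. Qed.

Lemma mpred_imply (P Q : X -> Prop) :
  measurable [set x | P x] -> measurable [set x | Q x] ->
  measurable [set x | P x -> Q x].
Proof.
move=> mP mQ; rewrite (_ : mkset _ = [set x | ~ P x \/ Q x]).
  by apply: mpred_or => //; exact: mpred_not.
apply/seteqP; split=> x /=; last by case.
by have [Px h|nPx _] := pselect (P x); [right; exact: h|left].
Qed.

Lemma mpred_forall_in (I : eqType) (s : seq I) (P : I -> X -> Prop) :
  (forall i, measurable [set x | P i x]) ->
  measurable [set x | forall i, i \in s -> P i x].
Proof.
move=> mP; rewrite (_ : mkset _ = [set x | forall j : 'I_(size s), P (tnth (in_tuple s) j) x]).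
  by apply: mpred_forall.
apply/seteqP; split=> x /= Px; first by move=> j; apply: Px; exact: mem_tnth.
by move=> i /(tnthP (in_tuple s))[j ->].
Qed.

Lemma mpred_comp (d' : measure_display) (Y : measurableType d')
    (f : X -> Y) (P : Y -> Prop) :
  measurable_fun setT f -> measurable [set y | P y] ->
  measurable [set x | P (f x)].
Proof. by move=> mf mP; have := mf measurableT _ mP; rewrite setTI. Qed.

End MeasurablePredicates.

Section Separation.
Variables (R : realType) (d d' : measure_display).
Variables (X : measurableType d) (Y : measurableType d').
Hypotheses (stdX : standard_borel R X) (stdY : standard_borel R Y).
Variable g : X -> Y.
Hypothesis mg : measurable_fun setT g.
Variables (I : finType) (J : set I).

Definition images_separated (P : I -> set X) :=
  exists C : I -> set Y,
    [/\ forall i, measurable (C i),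
        forall i, J i -> g @` P i `<=` C i &
        forall y, exists2 i, J i & ~ C i y].

(** All the index sets are split at the same time: if C t separates the pieces
    chosen by t, then the union over k of the intersections of the C t i over
    the t with t i = k still separates, since a common point would select a
    single t. *)
Lemma images_separated_split (P : I -> set X) (Q : nat -> set X) :
  (forall x, exists k, Q k x) ->
  (forall t : {ffun I -> nat}, images_separated (fun i => P i `&` Q (t i))) ->
  images_separated P.
Proof.
move=> cQ /choice[C hC].
exists (fun i => [set y | exists k, forall t : {ffun I -> nat},
                            t i = k -> C t i y]).
split=> [i|i Ji _ [x Px <-]|y].
- apply: mpred_exists => k; apply: mpred_forall => t.
  apply: mpred_imply; first exact: mpred_const.
  by have [mC _ _] := hC t; exact: mC.
- have [k Qkx] := cQ x; exists k => t tk.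
  by have [_ + _] := hC t; apply=> //; exists x => //; split=> //; rewrite tk.
- apply: contrapT => h.
  have /choice[t ht] : forall i, exists k, J i ->
      forall t : {ffun I -> nat}, t i = k -> C t i y.
    move=> i; have [Ji|nJi] := pselect (J i); last by exists 0%N.
    apply: contrapT => h'; apply: h; exists i => // -[k hk].
    by apply: h'; exists k.
  have [_ _ /(_ y)[i Ji]] := hC [ffun i => t i].
  by apply; apply: ht; rewrite // ffunE.
Qed.

(** Novikov's separation theorem for finitely many analytic sets.  If the
    images cannot be separated, then repeated splitting along the rows gives
    decreasing sequences of nonempty pieces that cannot be separated either.
    They converge to points x i of S i whose images are not all equal; a set
    of the separating family that distinguishes two of these images separates
    the pieces at a late stage. *)
Lemma separate_disjoint_images (S : I -> set X) :
  (forall i, measurable (S i)) ->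
  (forall y, exists2 i, J i & ~ (g @` S i) y) ->
  images_separated S.
Proof.
move=> mS dS.
have [b [mb sb]] := separating_family stdY.
pose B n := if unpickle n is Some c then
    match c with inl i => S i | inr k => g @^-1` b k end else set0.
have mB n : measurable (B n).
  rewrite /B; case: (unpickle n) => [[i|k]|]; last exact: measurable0.
    exact: mS.
  by rewrite -(setTI (_ @^-1` _)); exact: mg.
have [Q cQ hQ] := deciding_rows stdX mB.
apply: contrapT => nsep.
have /choice[nxt hnxt] : forall p : nat * (I -> set X),
    exists t : {ffun I -> nat}, ~ images_separated p.2 ->
    ~ images_separated (fun i => p.2 i `&` Q p.1 (t i)).
  move=> [m P] /=; have [sP|nsP] := pselect (images_separated P).
    by exists [ffun=> 0%N].
  apply: contrapT => h; apply: nsP.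
  apply: (images_separated_split (cQ m)) => t.
  by apply: contrapT => nst; apply: h; exists t.
pose P := fix P m : I -> set X := if m is m'.+1 then
  fun i => P m' i `&` Q m' (nxt (m', P m') i) else S.
have nsepP m : ~ images_separated (P m).
  by elim: m => [//|m IH]; exact: (hnxt (m, P m) IH).
have P_dec m k i : P (m + k)%N i `<=` P m i.
  by elim: k => [|k IH]; rewrite ?addn0 ?addnS //= => x [/IH].
have P_le m n i : (m <= n)%N -> P n i `<=` P m i.
  by move=> mn; rewrite -(subnKC mn); exact: P_dec.
have P_ne m i : J i -> P m i !=set0.
  move=> Ji; apply/set0P/negP => /eqP P0; apply: (nsepP m).
  exists (fun j => if j == i then set0 else setT); split=> [j|j Jj|y].
  - by case: ifP.
  - by case: ifP => // /eqP ->; rewrite P0 image_set0.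
  - by exists i => //; rewrite eqxx.
pose F i := filter_from setT (fun m => P m i).
have FP m i : F i (P m i) by exists m.
have PF i : J i -> ProperFilter (F i).
  move=> Ji; apply: filter_from_proper => [|m _]; last exact: P_ne.
  apply: filter_fromT_filter; first by exists 0%N.
  move=> m n; exists (maxn m n) => x Px.
  by split; apply: P_le Px; [exact: leq_maxl|exact: leq_maxr].
have /choice[x hx] : forall i, exists x, J i -> forall n, decides (F i) x (B n).
  move=> i; have [Ji|nJi] := pselect (J i); last by exists point.
  have FF := PF i Ji.
  have [m|x hx] := hQ (F i) FF; last by exists x.
  by exists (nxt (m, P m) i); exists m.+1 => // x [].
have xS i : J i -> S i (x i).
  move=> Ji; apply: contrapT => nS.
  have [_ ] := hx i Ji (pickle (inl i : I + nat)).
  rewrite /B pickleK => /(_ nS) nF; have FF := PF i Ji.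
  by have [z []] := @filter_ex _ _ FF _ (filterI (FP 0%N i) nF).
have FB i k : J i -> decides (F i) (x i) (g @^-1` b k).
  by move=> Ji; have := hx i Ji (pickle (inr k : I + nat)); rewrite /B pickleK.
have [i0 Ji0 _] := dS point.
have [j0 Jj0 gj] : exists2 j, J j & g (x i0) <> g (x j).
  apply: contrapT => h; have [i Ji] := dS (g (x i0)); apply.
  exists (x i); first exact: xS.
  by apply: contrapT => nE; apply: h; exists i => // /esym.
have sepij i j k : J i -> J j -> b k (g (x i)) -> ~ b k (g (x j)) -> False.
  move=> Ji Jj' bi nbj.
  have [m _ mi] := (FB i k Ji).1 bi.
  have [n _ nj] := (FB j k Jj').2 nbj.
  have ij : i != j by apply/eqP => ij; move: nbj; rewrite -ij.
  apply: (nsepP (maxn m n)).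
  exists (fun l => if l == i then b k else if l == j then ~` b k else setT).
  split=> [l|l Jl _ [z Pz <-]|y].
  - by case: ifP => // _; case: ifP => // _; exact: measurableC.
  - case: eqP => [li|_]; first by apply: mi; rewrite -li; apply: P_le Pz; exact: leq_maxl.
    case: eqP => // lj; apply: nj; rewrite -lj; apply: P_le Pz; exact: leq_maxr.
  - have [by_|nby] := pselect (b k y); last by exists i; rewrite ?eqxx.
    by exists j => //; rewrite eq_sym (negbTE ij) eqxx; exact.
by have [k [[]|[]]] := sb _ _ gj; apply: sepij.
Qed.

End Separation.

Definition multiplicity_le (I : finType) (Y : Type) (C : I -> set Y) k :=
  forall (W : {set I}) y, (forall i, i \in W -> C i y) -> (#|W| <= k)%N.

Section Envelopes.
Variables (R : realType) (d d' : measure_display).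
Variables (X : measurableType d) (Y : measurableType d').
Hypotheses (stdX : standard_borel R X) (stdY : standard_borel R Y).
Variable g : X -> Y.
Hypothesis mg : measurable_fun setT g.

(** The multiplicity bound says that more than k of the images never meet, so
    separation applies to every index set W of more than k elements.
    Intersecting, for each i, the separating sets over all W containing i
    keeps the bound. *)
Lemma image_envelopes (I : finType) (S : I -> set X) k :
  (forall i, measurable (S i)) ->
  multiplicity_le (fun i => g @` S i) k ->
  exists C : I -> set Y,
    [/\ forall i, measurable (C i), forall i, g @` S i `<=` C i &
        multiplicity_le C k].
Proof.
move=> mS hk.
have /choice[C hC] : forall W : {set I}, exists C : I -> set Y,
    (k < #|W|)%N -> [/\ forall i, measurable (C i),
        forall i, i \in W -> g @` S i `<=` C i &
        forall y, exists2 i, i \in W & ~ C i y].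
  move=> W; have [_|kW] := leqP #|W| k; first by exists (fun=> setT).
  have [y|C hC] := separate_disjoint_images stdX stdY mg mS (J := fun i => i \in W).
    apply: contrapT => h; move: kW; rewrite ltnNge (hk W y)// => i iW.
    by apply: contrapT => nS; apply: h; exists i.
  by exists C.
exists (fun i => [set y | forall W : {set I},
  (k < #|W|)%N /\ i \in W -> C W i y]).
split=> [i|i y Sy W [kW iW]|W y hW].
- apply: mpred_forall => W.
  have [[kW iW]|nW] := pselect ((k < #|W|)%N /\ i \in W).
    rewrite (_ : mkset _ = C W i); first by have [mC _ _] := hC W kW; exact: mC.
    by apply/seteqP; split=> y //=; apply.
  rewrite (_ : mkset _ = setT); first exact: measurableT.
  by apply/seteqP; split=> y //= _ /nW.
- by have [_ + _] := hC W kW; apply.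
- have [//|kW] := leqP; have [_ _ /(_ y)[i iW]] := hC W kW.
  by case; apply: hW.
Qed.

End Envelopes.

(** * Greedy colorings and binary codes *)

Lemma size_le_card (T : eqType) (A : set T) k (s : seq T) :
  A #<= `I_k -> uniq s -> (forall x, x \in s -> A x) -> (size s <= k)%N.
Proof.
move=> /pcard_leP[f] us sA.
have fk : {homo f : x / A x >-> (x < k)%N} by move=> x /(@funS _ _ _ _ f).
have fi : {in s &, injective f}.
  by move=> x y /sA Ax /sA Ay; apply: (@inj _ _ _ f); rewrite inE.
rewrite -(size_map f); apply: (@leq_trans (size (iota 0 k))); last by rewrite size_iota.
apply: uniq_leq_size; first by rewrite map_inj_in_uniq.
by move=> _ /mapP[x xs ->]; rewrite mem_iota add0n; apply: fk; exact: sA.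
Qed.

Definition fibers_le (X Y : Type) (g : X -> Y) k :=
  forall y, [set x | g x = y] #<= `I_k.

Lemma image_multiplicity (X : eqType) (Y : Type) (I : finType)
    (S : I -> set X) (g : X -> Y) k :
  (forall i j x, S i x -> S j x -> i = j) -> fibers_le g k ->
  multiplicity_le (fun i => g @` S i) k.
Proof.
move=> dS gk W y hW; have [->|[i0 i0W]] := set_0Vmem W; first by rewrite cards0.
have [x0 _ _] := hW i0 i0W.
have /choice[x hx] : forall i, exists x, i \in W -> S i x /\ g x = y.
  move=> i; have [iW|_] := boolP (i \in W); last by exists x0.
  by have [x Sx gx] := hW i iW; exists x.
rewrite cardE -(size_map x); apply: (size_le_card (gk y)).
  rewrite map_inj_in_uniq ?enum_uniq// => i j; rewrite !mem_enum => iW jW xij.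
  by apply: dS (hx i iW).1 _; rewrite xij; exact: (hx j jW).1.
by move=> _ /mapP[i + ->]; rewrite mem_enum => /hx[].
Qed.

Section Colorings.
Variables (d : measure_display) (X : measurableType d).

Definition finitely_colorable (G : X -> X -> Prop) :=
  exists K (c : X -> 'I_K), (forall v, measurable [set x | c x = v]) /\
    forall x y, G x y -> x <> y -> c x <> c y.

Lemma finitely_colorableW (C : finType) (c : X -> C) (G : X -> X -> Prop) :
  (forall v, measurable [set x | c x = v]) ->
  (forall x y, G x y -> x <> y -> c x <> c y) -> finitely_colorable G.
Proof.
move=> mc hc; exists #|C|, (fun x => enum_rank (c x)); split=> [v|x y Gxy xy].
  rewrite (_ : mkset _ = [set x | c x = enum_val v]); first exact: mc.
  apply/seteqP; split=> x /= => [<-|->]; by rewrite ?enum_rankK ?enum_valK.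
by move=> /enum_rank_inj; exact: hc.
Qed.

Lemma finitely_colorable_seq (I : eqType) (s : seq I) (G : I -> X -> X -> Prop) :
  (forall i, finitely_colorable (G i)) ->
  finitely_colorable (fun x y => exists2 i, i \in s & G i x y).
Proof.
move=> hG; elim: s => [|i s [K [c [mc hc]]]].
  apply: (@finitely_colorableW unit (fun=> tt)) => [v|x y [i]]//.
  by rewrite (_ : mkset _ = setT)//; apply/seteqP; split=> //= x _; case: v.
have [K' [c' [mc' hc']]] := hG i.
apply: (@finitely_colorableW ('I_K * 'I_K')%type (fun x => (c x, c' x))).
  move=> [v v']; rewrite (_ : mkset _ = [set x | c x = v /\ c' x = v']).
    by apply: mpred_and; [exact: mc|exact: mc'].
  by apply/seteqP; split=> x /= [-> ->].
move=> x y [j + Gj] xy [cxy c'xy]; rewrite inE => /predU1P[ji|js].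
  by apply: (hc' x y) c'xy; rewrite // -ji.
by apply: (hc x y) cxy => //; exists j.
Qed.

(** The sets A n, independent for G, are colored one after the other.  Given
    the part S colored so far, the Borel set B i contains every point with a
    neighbour of color i, and a point lies in at most D of the B i, so one of
    the D + 1 colors is free for it.  Taking the least free color keeps the
    color classes disjoint. *)
Lemma greedy_coloring (G : X -> X -> Prop) (A : nat -> set X) D :
  (forall x y, G x y -> G y x) ->
  (forall n, measurable (A n)) -> (forall x, exists n, A n x) ->
  (forall n x y, A n x -> A n y -> G x y -> x = y) ->
  (forall S : 'I_D.+1 -> set X, (forall i, measurable (S i)) ->
    (forall i j x, S i x -> S j x -> i = j) ->
    exists B : 'I_D.+1 -> set X, [/\ forall i, measurable (B i),
      forall i x y, S i y -> G x y -> B i x & multiplicity_le B D]) ->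
  finitely_colorable G.
Proof.
move=> Gs mA cA iA hB.
pose good (S : 'I_D.+1 -> set X) := (forall i, measurable (S i)) /\
  forall i j x, S i x -> S j x -> i = j.
have /choice[B {}hB] : forall S, exists B : 'I_D.+1 -> set X, good S ->
    [/\ forall i, measurable (B i),
      forall i x y, S i y -> G x y -> B i x & multiplicity_le B D].
  move=> S; have [[mS dS]|nS] := pselect (good S); last by exists S.
  by have [B ?] := hB S mS dS; exists B.
pose S := fix S n : 'I_D.+1 -> set X := if n is m.+1 then fun i =>
  [set x | S m i x \/ [/\ A m x, forall j, ~ S m j x, ~ B (S m) i x &
     forall j : 'I_D.+1, (j < i)%N -> B (S m) j x]] else fun=> set0.
have gS n : good (S n).
  elim: n => [|n [mS dS]]; first by split=> // i; exact: measurable0.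
  have [mB _ _] := hB (S n) (conj mS dS).
  split=> [i|i j x] /=.
    apply: mpred_or; first exact: mS.
    rewrite (_ : mkset _ = [set x | A n x /\ ((forall j, ~ S n j x) /\
      (~ B (S n) i x /\
       forall j : 'I_D.+1, (j < i)%N -> B (S n) j x))]); last first.
      by apply/seteqP; split=> [x []|x /= [? [? []]]].
    apply: mpred_and; first exact: mA.
    apply: mpred_and; first by apply: mpred_forall => j; exact/mpred_not/mS.
    apply: mpred_and; first exact/mpred_not/mB.
    apply: mpred_forall => j; apply: mpred_imply; last exact: mB.
    exact: mpred_const.
  move=> [Si|[_ nS nBi ltBi]] [Sj|[_ nS' nBj ltBj]].
  - exact: dS Si Sj.
  - by have := nS' i.
  - by have := nS j.
  - by apply/val_inj; case: (ltngtP i j) => // [/ltBj|/ltBi].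
have Sle m n i x : (m <= n)%N -> S m i x -> S n i x.
  by move=> /subnKC <-; elim: (n - m)%N => [|k IH]; rewrite ?addn0 ?addnS //= => /IH; left.
have pS n i x y : S n i x -> S n i y -> G x y -> x = y.
  elim: n => [//|n IH] /=; have [_ hBS _] := hB (S n) (gS n).
  move=> [Sx|[Ax _ nBx _]] [Sy|[Ay _ nBy _]] Gxy.
  - exact: IH.
  - by case: nBy; apply: hBS Sx (Gs _ _ Gxy).
  - by case: nBx; apply: hBS Sy Gxy.
  - exact: iA Ax Ay Gxy.
have cS x : exists i, exists n, S n i x.
  have [n Anx] := cA x; have [_ _ mulB] := hB (S n) (gS n).
  have [[i Si]|nS] := pselect (exists i, S n i x); first by exists i, n.
  have [i0 nBi0] : exists i, ~ B (S n) i x.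
    apply: contrapT => h; have := mulB [set: 'I_D.+1]%SET x.
    rewrite cardsT card_ord ltnn => F; apply: (notF (F _)) => i _.
    by apply: contrapT => nBi; apply: h; exists i.
  have ex : exists k, [exists i : 'I_D.+1, (val i == k) && ~~ `[< B (S n) i x >]].
    by exists (val i0); apply/existsP; exists i0; rewrite eqxx; exact/asboolPn.
  case: (ex_minnP ex) => k /existsP[i /andP[/eqP <- /asboolPn nBi]] mini.
  exists i, n.+1; right; split=> // [j Sj|j ji]; first by apply: nS; exists j.
  apply: contrapT => nBj; move: ji; rewrite ltnNge mini//.
  by apply/existsP; exists j; rewrite eqxx; exact/asboolPn.
have [c hc] := choice cS.
apply: (@finitely_colorableW _ c) => [v|x y Gxy xy cxy].
  rewrite (_ : mkset _ = [set x | exists n, S n v x]).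
    by apply: mpred_exists => n; exact: (gS n).1.
  apply/seteqP; split=> x /= => [<-//|[n Sn]].
  have [m Sm] := hc x.
  by apply: (gS (maxn m n)).2; [apply: Sle Sm; exact: leq_maxl|
    apply: Sle Sn; exact: leq_maxr].
have [m Sm] := hc x; have [n Sn] := hc y; apply: xy.
apply: (pS (maxn m n) (c x)) => //.
  by apply: Sle Sm; exact: leq_maxl.
by rewrite cxy; apply: Sle Sn; exact: leq_maxr.
Qed.

End Colorings.

Section BinaryCode.
Variables (d : measure_display) (X : measurableType d) (b : nat -> set X).
Hypothesis mb : forall n, measurable (b n).
Hypothesis sb :
  forall x y, x <> y -> exists n, (b n x /\ ~ b n y) \/ (b n y /\ ~ b n x).

(** The integer with binary digits b 0 x, ..., b (n-1) x: comparing two points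
    by these integers is the lexicographic order, hence the comparison does not
    change once the codes differ. *)
Fixpoint prefix_code n x : nat :=
  if n is m.+1 then (prefix_code m x).*2 + `[< b m x >] else 0.

Lemma prefix_code_lt n x : (prefix_code n x < 2 ^ n)%N.
Proof.
elim: n => [//|n IH] /=; rewrite expnS.
by case: `[< b n x >] => /=; lia.
Qed.

Lemma prefix_code_homo m n x y : (m <= n)%N ->
  (prefix_code m x < prefix_code m y)%N -> (prefix_code n x < prefix_code n y)%N.
Proof.
move=> /subnKC <-; elim: (n - m)%N => [|k IH]; rewrite ?addn0 ?addnS //= => /IH.
by case: `[< _ x >]; case: `[< _ y >] => /=; lia.
Qed.

Lemma prefix_code_sep x y : x <> y ->
  exists n, prefix_code n x <> prefix_code n y.
Proof.
move=> /sb[n hn]; exists n.+1 => /=.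
have nbit : `[< b n x >] <> `[< b n y >].
  by case: hn => -[/asboolP -> /asboolPn /negbTE ->].
by move: nbit; case: `[< _ x >]; case: `[< _ y >] => //=; lia.
Qed.

Lemma measurable_prefix_code n s : measurable [set x | prefix_code n x = s].
Proof.
elim: n s => [|n IH] s /=; first exact: mpred_const.
rewrite (_ : mkset _ = [set x | exists t, prefix_code n x = t /\
    ((b n x /\ t.*2.+1 = s) \/ (~ b n x /\ t.*2 = s))]).
  apply: mpred_exists => t; apply: mpred_and; first exact: IH.
  apply: mpred_or; apply: mpred_and; try exact: mpred_const.
    exact: mb.
  exact/mpred_not/mb.
apply/seteqP; split=> x /=.
  move=> <-; exists (prefix_code n x); split=> //.
  by case: (asboolP (b n x)) => bx /=; [left|right]; split=> //; rewrite ?addn1 ?addn0.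
by move=> [t [-> [[/asboolP ->]|[/asboolPn/negbTE ->]]]] /=; rewrite ?addn1 ?addn0.
Qed.

End BinaryCode.

(** * Finite colorings of the graph f x = g y *)

Section ColoringTheorem.
Variables (R : realType) (d : measure_display) (X : measurableType d).
Hypothesis stdX : standard_borel R X.

(** For every n enclose the images of the 2^n sets of constant prefix code in
    Borel sets C n s of multiplicity at most k.  Let L j x mean that, for
    infinitely many n, at least j codes s smaller than the code of x satisfy
    C n s (g x).  In a fiber of g a larger point has, for large n, also the
    code of the smaller point among these s; so the largest j with L j x
    increases strictly along the fiber. *)
Lemma fiber_coloring (g : X -> X) k :
  measurable_fun setT g -> fibers_le g k ->
  finitely_colorable (fun x y => g x = g y).
Proof.
move=> mg gk; have [b [mb sb]] := separating_family stdX.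
pose code := prefix_code b.
have mcode n s : measurable [set x | code n x = s] by exact: measurable_prefix_code.
have exC n : exists C : 'I_(2 ^ n) -> set X,
    [/\ forall s, measurable (C s),
        forall s : 'I_(2 ^ n), g @` [set x | code n x = s] `<=` C s & multiplicity_le C k].
  apply: (image_envelopes stdX stdX mg) => [s|]; first exact: mcode.
  by apply: image_multiplicity gk => i j x /= ->; exact: val_inj.
pose C n := sval (cid (exC n)); have hC n := svalP (cid (exC n)).
rewrite -/(C _) in hC.
pose L_ n j x := exists W : {set 'I_(2 ^ n)}, (j <= #|W|)%N /\
  forall s : 'I_(2 ^ n), s \in W -> (s < code n x)%N /\ C n s (g x).
pose L j x := forall N, exists n, (N <= n)%N /\ L_ n j x.
have mL j : measurable [set x | L j x].
  apply: mpred_forall => N; apply: mpred_exists => n; apply: mpred_and.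
    exact: mpred_const.
  apply: mpred_exists => W; apply: mpred_and; first exact: mpred_const.
  apply: mpred_forall => s; apply: mpred_imply; first exact: mpred_const.
  apply: mpred_and; last first.
    by apply: (mpred_comp (P := C n s)) => //; have [mC _ _] := hC n; exact: mC.
  rewrite (_ : mkset _ = [set x | exists t, code n x = t /\ (s < t)%N]).
    apply: mpred_exists => t; apply: mpred_and; first exact: mcode.
    exact: mpred_const.
  by apply/seteqP; split=> x /= => [sx|[t [->]]//]; exists (code n x).
have L_le n j x : L_ n j x -> (j <= k)%N.
  move=> [W [jW hW]]; apply: leq_trans jW _; have [_ _ hk] := hC n.
  by apply: (hk W (g x)) => s /hW[].
have L0 x : L 0%N x.
  by move=> N; exists N; split=> //; exists finset.set0; split=> // s; rewrite inE.
(* The code of x is one more admissible code below that of y. *)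
have LS x y j : g x = g y -> (exists m, code m x < code m y)%N ->
    L j x -> L j.+1 y.
  move=> gxy [m xy] Lx N; have [n [Nn [W [jW hW]]]] := Lx (maxn m N).
  have xyn : (code n x < code n y)%N.
    apply: prefix_code_homo xy; apply: leq_trans Nn; exact: leq_maxl.
  exists n; split; first by apply: leq_trans Nn; exact: leq_maxr.
  pose s0 := Ordinal (prefix_code_lt b n x).
  exists (s0 |: W)%SET; split=> [|s].
    rewrite cardsU1 (_ : s0 \notin W) ?add1n//.
    by apply/negP => /hW[]; rewrite /= ltnn.
  rewrite in_setU1 => /predU1P[->|/hW[sx Cs]]; last first.
    by rewrite -gxy; split=> //; exact: ltn_trans xyn.
  split=> //; rewrite -gxy; have [_ + _] := hC n; apply.
  by exists x.
pose c x : {ffun 'I_k.+1 -> bool} := [ffun j : 'I_k.+1 => `[< L j x >]].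
have sep x y : g x = g y -> (exists m, code m x < code m y)%N -> c x <> c y.
  move=> gxy xy cxy.
  have exL : exists j, `[< L j x >] by exists 0%N; exact/asboolP.
  have ubL j : `[< L j x >] -> (j <= k)%N.
    by move=> /asboolP/(_ 0%N)[n [_]]; exact: L_le.
  case: (ex_maxnP exL ubL) => j /asboolP Lj maxj.
  have Ly := LS _ _ _ gxy xy Lj.
  have jk : (j.+1 < k.+1)%N by have [n [_ /L_le]] := Ly 0%N.
  have := congr1 (fun h : {ffun 'I_k.+1 -> bool} => h (Ordinal jk)) cxy.
  rewrite !ffunE /= (asboolT Ly) => /asboolP/asboolT/maxj.
  by rewrite ltnn.
apply: (@finitely_colorableW _ _ _ c) => [v|x y gxy xy].
  rewrite (_ : mkset _ = [set x | forall j : 'I_k.+1, L j x <-> v j]).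
    apply: mpred_forall => j; apply: mpred_and; apply: mpred_imply => //;
      exact: mpred_const.
  apply/seteqP; split=> x /= => [<- j|h].
    by rewrite ffunE; split=> [/asboolT|/asboolP].
  apply/ffunP => j; rewrite ffunE; have [h1 h2] := h j.
  by apply/idP/idP => [/asboolP/h1|/h2/asboolP].
have [n] := prefix_code_sep sb xy; case: (ltngtP (code n x) (code n y)) => // cn _.
  by apply: sep => //; exists n.
by apply/nesym; apply: sep; [exact: esym|exists n].
Qed.

(** As g is injective on Q, the images of the parts of Q inside and outside
    b n are disjoint and can be separated by a Borel set C n.  Then C n (f x)
    tells the n-th digit of the point y of Q with g y = f x.  Points whose n-th
    digit is i and for which C n (f x) predicts the opposite digit form an
    independent set, and so do the points with no wrong prediction, because
    the digits determine a point.  The greedy algorithm turns this countable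
    coloring into a finite one. *)
Lemma partial_injection_coloring (f g : X -> X) (Q : set X) k :
  measurable_fun setT f -> measurable_fun setT g -> fibers_le f k ->
  measurable Q -> (forall x y, Q x -> Q y -> g x = g y -> x = y) ->
  finitely_colorable (fun x y => f x = g y /\ Q y \/ f y = g x /\ Q x).
Proof.
move=> mf mg fk mQ gi; have [b [mb sb]] := separating_family stdX.
have /choice[C hC] : forall n, exists C : set X, measurable C /\
    forall x, Q x -> b n x <-> C (g x).
  move=> n; pose S (i : bool) := Q `&` (if i then b n else ~` b n).
  have [||C [mC CS hC]] := @image_envelopes _ _ _ _ _ stdX stdX g mg _ S 1%N.
  - by case; apply: measurableI => //; exact: measurableC.
  - move=> W y hW; rewrite leqNgt; apply/negP => /card_gt1P[i [j [iW jW ij]]].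
    have [x [Qx bx] gx] := hW i iW; have [z [Qz bz] gz] := hW j jW.
    have xz : x = z by apply: gi; rewrite // gx gz.
    by move: ij bx bz; rewrite xz; case: (i); case: (j).
  exists (C true); split=> // x Qx; split=> [bx|Ctx].
    by apply: CS; exists x.
  apply: contrapT => nbx.
  suff /(hC [set: bool]%SET) : forall i : bool, i \in [set: bool]%SET -> C i (g x).
    by rewrite cardsT card_bool.
  by case=> _ //; apply: CS; exists x.
(* The points without wrong prediction come first, then the pairs (n, digit). *)
pose A m := if m is m'.+1 then
  if unpickle m' is Some (n, i) then
    if i then [set x | b n x /\ ~ C n (f x)] else [set x | ~ b n x /\ C n (f x)]
  else set0
  else [set x | forall n : nat, b n x <-> C n (f x)].
have mCf n : measurable [set x | C n (f x)].
  by apply: mpred_comp => //; exact: (hC n).1.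
have iA m x y : A m x -> A m y -> f x = g y /\ Q y -> x = y.
  case: m => [Ax Ay|m /=].
    move=> [fgxy Qy]; apply: contrapT => /sb[n].
    by have := Ax n; rewrite fgxy; have := (hC n).2 y Qy; tauto.
  case: (unpickle m) => [[n i]|//]; case: i => -[bx Cx] [by_ _] [fgxy Qy];
    have := (hC n).2 y Qy; rewrite -fgxy; tauto.
(* A point has at most one neighbour y in Q with g y = f x and, if it lies
   in Q, at most k neighbours y with f y = g x. *)
apply: (@greedy_coloring _ _ _ A k.+1).
- by move=> x y; tauto.
- case=> [|m] /=.
    apply: mpred_forall => n; apply: mpred_and; apply: mpred_imply => //; exact: mb.
  case: (unpickle m) => [[n i]|]; last exact: measurable0.
  case: i; apply: mpred_and => //; [exact: mb|exact: mpred_not|].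
  by apply: mpred_not; exact: mb.
- move=> x; have [h|h] := pselect (A 0%N x); first by exists 0%N.
  have [n hn] : exists n, ~ (b n x <-> C n (f x)).
    by apply: contrapT => h'; apply: h => n; apply: contrapT => h''; apply: h'; exists n.
  have [bx|nbx] := pselect (b n x).
    by exists (pickle (n, true)).+1; rewrite /A pickleK; split=> //; tauto.
  exists (pickle (n, false)).+1; rewrite /A pickleK; split=> //.
  by apply: contrapT => nC; apply: hn; tauto.
- move=> m x y Ax Ay [/(iA _ _ _ Ax Ay)//|/(iA _ _ _ Ay Ax)//].
- move=> S mS dS.
  have [||U [mU SU hU]] :=
      @image_envelopes _ _ _ _ _ stdX stdX g mg _ (fun i => S i `&` Q) 1%N.
  + by move=> i; exact: measurableI.
  + move=> W y hW; rewrite leqNgt; apply/negP => /card_gt1P[i [j [iW jW /eqP[]]]].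
    have [x [Sx Qx] gx] := hW i iW; have [z [Sz Qz] gz] := hW j jW.
    have xz : x = z by apply: gi; rewrite // gx gz.
    by apply: dS Sx _; rewrite xz.
  have [V [mV SV hV]] := image_envelopes stdX stdX mf mS (image_multiplicity dS fk).
  exists (fun i => [set x | U i (f x) \/ V i (g x)]); split=> [i|i x y Sy|W y hW].
  + apply: mpred_or; first exact: (mpred_comp (P := U i) mf (mU i)).
    exact: (mpred_comp (P := V i) mg (mV i)).
  + move=> [[fg Qy]|[fg Qx]]; [left|right].
      by rewrite fg; apply: SU; exists y.
    by rewrite -fg; apply: SV; exists y.
  + pose W1 := [set i in W | `[< U i (f y) >]]%SET.
    have h1 : (#|W1| <= 1)%N.
      by apply: (hU W1 (f y)) => i; rewrite inE => /andP[_ /asboolP].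
    have h2 : (#|W :\: W1|%SET <= k)%N.
      apply: (hV _ (g y)) => i; rewrite !inE => /andP[+ iW].
      by rewrite iW /= => /asboolPn nU; case: (hW i iW).
    apply: leq_trans (leq_add h1 h2); rewrite -cardsUI.
    apply: leq_trans (leq_addr _ _); apply: subset_leq_card.
    by apply/fintype.subsetP => i iW; rewrite !inE iW; case: (asboolP (U i _)).
Qed.

(** A finite coloring of the fibers of g splits the graph into finitely many
    graphs of partial injections. *)
Lemma finitely_colorable_span (f g : X -> X) k l :
  measurable_fun setT f -> measurable_fun setT g ->
  fibers_le f k -> fibers_le g l ->
  finitely_colorable (fun x y => f x = g y).
Proof.
move=> mf mg fk gl; have [K [e [me he]]] := fiber_coloring mg gl.
have hj (j : 'I_K) : finitely_colorable (fun x y =>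
    f x = g y /\ e y = j \/ f y = g x /\ e x = j).
  apply: (partial_injection_coloring mf mg fk (me j)) => x y /= ex ey gxy.
  by apply: contrapT => /(he _ _ gxy); rewrite ex ey.
have [K' [c [mc hc]]] := finitely_colorable_seq (enum 'I_K) hj.
exists K', c; split=> // x y fgxy; apply: hc.
by exists (e y); rewrite ?mem_enum//; left.
Qed.

End ColoringTheorem.

(** * Rational coordinates on the monoid *)

Section TensorTorsion.
Variable A : zmodType.

(** The value of s in A after multiplication by N, when N is a common multiple
    of the denominators occurring in s; rounding makes it a total function. *)
Definition cleared (N : nat) (s : seq (A * rat^o)) : A :=
  \sum_(p <- s) p.1 *~ Num.floor (N%:R * p.2 : rat).

Lemma natr_mul_int (N : nat) (q : rat) :
  (`|denq q| %| N)%N -> N%:R * q \is a Num.int.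
Proof.
move=> /dvdnP[m ->]; rewrite natrM -mulrA natr_absz gtr0_norm ?denq_gt0 //.
have -> : ((denq q)%:~R * q : rat) = (numq q)%:~R.
  by rewrite mulrC numqE.
by rewrite -[m%:R]/(m%:Z%:~R) -intrM; exact: intr_int.
Qed.

(** The congruence only identifies sums with the same value once denominators
    are cleared; divisibility by N0 makes the bound stable under common
    multiples, which the transitive and concatenation steps require. *)
Lemma tensor_cong_cleared (s t : seq (A * rat^o)) : tensor_cong s t ->
  exists2 N0, (0 < N0)%N & forall N, (N0 %| N)%N -> cleared N s = cleared N t.
Proof.
elim=> {s t}.
- by move=> s; exists 1%N.
- by move=> s t _ [N0 N0_gt0 h]; exists N0 => // N /h.
- move=> s t u _ [N0 N0_gt0 h] _ [N1 N1_gt0 h1]; exists (N0 * N1)%N.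
    by rewrite muln_gt0 N0_gt0.
  move=> N dN; rewrite h ?h1//; apply: dvdn_trans dN; first exact: dvdn_mull.
  exact: dvdn_mulr.
- move=> s s' t t' _ [N0 N0_gt0 h] _ [N1 N1_gt0 h1]; exists (N0 * N1)%N.
    by rewrite muln_gt0 N0_gt0.
  move=> N dN; rewrite /cleared !big_cat /=; congr (_ + _).
    by apply: h; apply: dvdn_trans dN; rewrite dvdn_mulr.
  by apply: h1; apply: dvdn_trans dN; rewrite dvdn_mull.
- by move=> s t; exists 1%N => // N _; rewrite /cleared !big_cat /= addrC.
- move=> a a' b; exists 1%N => // N _.
  by rewrite /cleared !big_cons !big_nil /= !addr0 mulrzDl.
- move=> a b b'; exists `|denq b|%N; first by rewrite absz_gt0 denq_neq0.
  move=> N dN; rewrite /cleared !big_cons !big_nil /= !addr0 -mulrzDr.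
  by rewrite mulrDr floorDzr// natr_mul_int.
- by move=> b; exists 1%N => // N _; rewrite /cleared big_cons big_nil /= mul0rz addr0.
- move=> a; exists 1%N => // N _.
  by rewrite /cleared big_cons big_nil /= mulr0 floor0 mulr0z addr0.
Qed.

(** The kernel of A -> A (x) Q is the torsion of A. *)
Lemma rational_embedding r : inhabited (Vector.axiom r (tensor A rat^o)) ->
  exists phi : {additive A -> 'rV[rat]_r},
    forall a, phi a = 0 -> exists2 N, (0 < N)%N & a *+ N = 0.
Proof.
move=> [[f f_lin /bij_inj f_inj]].
pose e (a : A) : tensor A rat^o := tensor_pi [:: (a, 1)].
have eD a b : e (a + b) = e a + e b.
  rewrite /e -[RHS]/(tensor_add _ _) tensor_addE.
  by apply/tensor_piP; exact: tensor_addl.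
have fD x y : f (x + y) = f x + f y by have := f_lin 1 x y; rewrite !scale1r.
have f0 : f 0 = 0 by apply: (addrI (f 0)); rewrite -fD !addr0.
have phiB : zmod_morphism (fun a => f (e a)).
  by move=> a b; apply/eqP; rewrite eq_sym subr_eq -fD -eD subrK.
pose aM := GRing.isZmodMorphism.Build A 'rV[rat]_r (fun a => f (e a)) phiB.
pose phi : {additive A -> 'rV[rat]_r} := HB.pack (fun a => f (e a)) aM.
exists phi => a; rewrite -[phi a]/(f (e a)) -[RHS]f0 => /f_inj.
move=> /tensor_piP/tensor_cong_cleared[N N_gt0 /(_ N (dvdnn N))].
rewrite /cleared big_cons !big_nil /= mulr1 addr0 => h.
by exists N => //; rewrite -h -[N%:R]/(N%:Z%:~R) intrKfloor pmulrn.
Qed.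

End TensorTorsion.

Section FiniteBalls.
Variables (G : zmodType) (r : nat) (phi : {additive G -> 'rV[rat]_r}).
Hypothesis phi_torsion :
  forall g, phi g = 0 -> exists2 N, (0 < N)%N & g *+ N = 0.

Fixpoint zspan (S : seq G) (g : G) : Prop :=
  if S is s :: S' then exists z : int, zspan S' (g - s *~ z) else g = 0.

Lemma zspan0 S : zspan S 0.
Proof. by elim: S => [//|s S IH]; exists 0; rewrite mulr0z subr0. Qed.

Lemma zspanD S g h : zspan S g -> zspan S h -> zspan S (g + h).
Proof.
elim: S g h => [|s S IH] g h /=; first by move=> -> ->; rewrite addr0.
by move=> [y gy] [z hz]; exists (y + z); rewrite mulrzDr opprD addrACA; exact: IH.
Qed.

Lemma zspanN S g : zspan S g -> zspan S (- g).
Proof.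
elim: S g => [|s S IH] g /=; first by move=> ->; rewrite oppr0.
by move=> [z gz]; exists (- z); rewrite mulrNz opprK addrC -opprB; exact: IH.
Qed.

Lemma zspanMz S g z : zspan S g -> zspan S (g *~ z).
Proof.
move=> gS; elim/int_ind: z => [|n IH|n IH]; first by rewrite mulr0z; exact: zspan0.
  by rewrite -addn1 PoszD mulrzDr; exact: zspanD.
by rewrite -addn1 PoszD opprD mulrzDr; apply: zspanD => //; rewrite mulrNz; exact: zspanN.
Qed.

Lemma zspan_mem S g : g \in S -> zspan S g.
Proof.
elim: S => [//|s S IH]; rewrite inE => /predU1P[->|gS]; last first.
  by exists 0; rewrite mulr0z subr0; exact: IH.
by exists 1; rewrite subrr; exact: zspan0.
Qed.

Lemma zspan_sum S (I : Type) (s : seq I) (F : I -> G) :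
  (forall i, zspan S (F i)) -> zspan S (\sum_(i <- s) F i).
Proof.
by move=> hF; elim/big_ind: _ => //; [exact: zspan0|exact: zspanD].
Qed.

Definition sup_le (v : 'rV[rat]_r) (B : rat) := forall i, `|v 0 i| <= B.

Lemma sup_leD u v B C : sup_le u B -> sup_le v C -> sup_le (u + v) (B + C).
Proof. by move=> hu hv i; rewrite mxE (le_trans (ler_normD _ _))// lerD. Qed.

Lemma sup_leN v B : sup_le v B -> sup_le (- v) B.
Proof. by move=> hv i; rewrite mxE normrN. Qed.

Definition norm1 (v : 'rV[rat]_r) : rat := \sum_i `|v 0 i|.

Lemma norm1_ge0 v : 0 <= norm1 v. Proof. exact: sumr_ge0. Qed.

Lemma sup_le_norm1 v : sup_le v (norm1 v).
Proof. by move=> i; rewrite /norm1 (bigD1 i)//= lerDl sumr_ge0. Qed.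

Lemma sup_leMz v (z : int) (Z : nat) :
  (`|z| <= Z)%N -> sup_le (v *~ z) (Z%:R * norm1 v).
Proof.
move=> zZ i; rewrite -scaler_int mxE normrM ler_pM//; last exact: sup_le_norm1.
by rewrite -intr_norm -abszE -[leLHS]/(`|z|%N%:R) ler_nat.
Qed.

(** Induction on the generators.  If phi s is a rational combination of the
    images of the other generators, then a positive multiple of s lies in their
    span, and the coefficient of s can be reduced modulo that multiple.
    Otherwise a linear form vanishing on the images of the other generators,
    but not on phi s, bounds the coefficient of s. *)
Lemma zspan_ball_finite S (B : rat) :
  exists L : seq G, forall g, zspan S g -> sup_le (phi g) B -> g \in L.
Proof.
elim: S B => [|s S IH] B; first by exists [:: 0] => g /= -> _; rewrite inE.
suff [Z hZ] : exists Z : nat, forall g, zspan (s :: S) g -> sup_le (phi g) B ->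
    exists2 z : int, (`|z| <= Z)%N & zspan S (g - s *~ z).
  have [L hL] := IH (B + Z%:R * norm1 (phi s)).
  exists [seq s *~ (i%:Z - Z%:Z) + l | i <- iota 0 (Z + Z).+1, l <- L] => g gS gB.
  have [z zZ gz] := hZ g gS gB.
  apply/allpairsP; exists (absz (z + Z%:Z), g - s *~ z); split => /=.
  - by rewrite -[_ :: _]/(iota 0 (Z + Z).+1) mem_iota; lia.
  - apply: hL => //; rewrite raddfB raddfMz; apply: sup_leD => //.
    by apply: sup_leN; exact: sup_leMz.
  - by rewrite (_ : _ - _ = z :> int); [rewrite addrC subrK|lia].
pose W := \matrix_(i < size S) phi S`_i.
have [sW|nsW] := boolP (phi s <= W)%MS.
  have [c cE] := submxP sW.
  pose N := (\prod_(i < size S) `|denq (c 0%R i)|)%N.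
  have N_gt0 : (0 < N)%N by rewrite prodn_gt0// => i; rewrite absz_gt0 denq_neq0.
  have Nc i : N%:R * c 0 i = (Num.floor (N%:R * c 0 i))%:~R.
    rewrite floorK//; apply: natr_mul_int.
    by rewrite /N (bigD1 i)//= dvdn_mulr.
  pose h := \sum_(i < size S) S`_i *~ Num.floor (N%:R * c 0 i).
  have hS : zspan S h.
    by apply: zspan_sum => i; apply: zspanMz; apply: zspan_mem; exact: mem_nth.
  have [|N' N'_gt0 hN'] := phi_torsion (g := s *+ N - h).
    rewrite raddfB raddfMn raddf_sum /= cE; apply/eqP; rewrite subr_eq0; apply/eqP.
    rewrite mulmx_sum_row -scaler_nat scaler_sumr; apply: eq_bigr => i _.
    by rewrite raddfMz -scaler_int -Nc scalerA rowK.
  pose N2 := (N * N')%N; have N2_gt0 : (0 < N2)%N by rewrite muln_gt0 N_gt0.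
  have sN2 : zspan S (s *+ N2).
    have -> : s *+ N2 = h *+ N'.
      by apply/eqP; rewrite -subr_eq0 mulrnA -mulrnBl hN'.
    by rewrite pmulrn; exact: zspanMz.
  exists N2 => g [z gz] _.
  have [q [t [zE t_ge0 t_lt]]] : exists q t : int, [/\ z = q * N2%:Z + t, 0 <= t & t < N2%:Z].
    exists (z %/ N2)%Z, (z %% N2)%Z; split; first exact: divz_eq.
      by apply: modz_ge0; lia.
    by apply: ltz_pmod; lia.
  exists t; first lia.
  rewrite (_ : g - s *~ t = (g - s *~ z) + (s *+ N2) *~ q).
    by apply: zspanD => //; exact: zspanMz.
  by rewrite zE mulrzDr [q * _]mulrC mulrzA -pmulrn opprD addrA [in RHS]addrAC subrK.
move: (nsW); rewrite submxE => /rV0Pn[j wj].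
pose lam (v : 'rV[rat]_r) := (v *m cokermx W) 0 j.
have memW s' : s' \in S -> (phi s' <= W)%MS.
  move=> /(nthP 0)[i iS <-]; have -> : phi S`_i = row (Ordinal iS) W by rewrite rowK.
  exact: row_sub.
have spanW (S' : seq G) g : {subset S' <= S} -> zspan S' g -> (phi g <= W)%MS.
  elim: S' g => [|s' S' IHS'] g /= S'S; first by move=> ->; rewrite raddf0 sub0mx.
  move=> [z gz]; rewrite -(subrK (s' *~ z) g) raddfD; apply: addmx_sub.
    by apply: IHS' gz => t tS'; apply: S'S; rewrite inE tS' orbT.
  rewrite raddfMz -scaler_int; apply: scalemx_sub; apply: memW; apply: S'S.
  exact: mem_head.
have lamS g : zspan S g -> lam (phi g) = 0.
  by move=> /spanW; rewrite submxE /lam => /(_ (fun=> id))/eqP ->; rewrite mxE.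
pose K := B * \sum_i `|cokermx W i j|.
have lamB v : sup_le v B -> `|lam v| <= K.
  move=> vB; rewrite /lam mxE /K mulr_sumr; apply: le_trans (ler_norm_sum _ _ _) _.
  by apply: ler_sum => i _; rewrite normrM ler_wpM2r.
exists (Num.bound `|K / `|lam (phi s)| |) => g [z gz] gB; exists z => //.
have lamg : lam (phi g) = z%:~R * lam (phi s).
  have lamBZ u v : lam (u - z%:~R *: v) = lam u - z%:~R * lam v.
    by rewrite /lam mulmxBl -scalemxAl [LHS]mxE [X in _ + X = _]mxE [X in _ - X = _]mxE.
  have := lamS _ gz; rewrite raddfB raddfMz -scaler_int lamBZ.
  by move=> /eqP; rewrite subr_eq0 => /eqP.
have := lamB _ gB; rewrite lamg normrM -ler_pdivlMr ?normr_gt0// -intr_norm => zK.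
have := le_lt_trans (le_trans zK (ler_norm _)) (archi_boundP (normr_ge0 _)).
by rewrite -abszE -[ltLHS]/(`|z|%N%:R) ltr_nat => /ltnW.
Qed.

End FiniteBalls.

Section RankCoordinates.
Variable M : nmodType.

Definition gp_of (m : M) : gpcompl M := gp_pi (m, 0).

Lemma gp_ofD a b : gp_of (a + b) = gp_of a + gp_of b.
Proof.
rewrite -[RHS]/(gp_add (gp_pi (a, 0)) (gp_pi (b, 0))) gp_addE; congr gp_pi.
by rewrite -[RHS]/(a + b, 0 + 0) addr0.
Qed.

Lemma gp_of_sum (I : Type) (s : seq I) (F : I -> M) :
  gp_of (\sum_(i <- s) F i) = \sum_(i <- s) gp_of (F i).
Proof. by elim/big_ind2: _ => // [? a ? b <- <-]; exact: gp_ofD. Qed.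

Lemma gp_of_eq a b : gp_of a = gp_of b <-> exists k, a + k = b + k.
Proof. by rewrite gp_piP /=; split=> -[k]; exists k; rewrite ?addr0// in p *. Qed.

Lemma gp_repr_sub (g : gpcompl M) : g = gp_of (repr g).1 - gp_of (repr g).2.
Proof.
move: (gp_piK g); case: (repr g) => a b <- /=.
apply/eqP; rewrite eq_sym subr_eq; apply/eqP.
rewrite -[RHS]/(gp_add (gp_pi (a, b)) (gp_pi (b, 0))) gp_addE.
by apply/gp_piP; exists 0; rewrite /= !addr0 addrC.
Qed.

(** E represents u + g for all g in the finite ball of radius B of M^gp, where
    u is the sum of the negative parts of these g. *)
Lemma rank_coordinates (S : seq M) r : generates S -> has_rank M r ->
  exists psi : M -> 'rV[rat]_r,
    (forall a b, psi (a + b) = psi a + psi b) /\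
    forall B, 0 <= B -> exists (u : M) (E : seq M),
      [/\ u \in E,
          forall m, m \in E -> sup_le (psi m - psi u) B &
          forall a b, sup_le (psi a - psi b) B ->
            exists2 m, m \in E & exists k, a + u + k = b + m + k].
Proof.
move=> genS /rational_embedding[phi phi_torsion].
exists (fun m => phi (gp_of m)); split=> [a b|B B_ge0].
  by rewrite gp_ofD raddfD.
have spanM m : zspan (map gp_of S) (gp_of m).
  have [w wS ->] := genS m; rewrite gp_of_sum big_seq_cond.
  elim/big_ind: _ => [||s]; [exact: zspan0|exact: zspanD|].
  by rewrite andbT => /wS sS; apply: zspan_mem; exact: map_f.
have [L hL] := zspan_ball_finite phi_torsion (map gp_of S) B.
pose L' := [seq g <- L | [forall i, `|phi g 0 i| <= B]].
(* Adding u to g cancels the negative part of g, leaving the element e g. *)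
pose u : M := \sum_(g <- L') (repr g).2.
pose e (g : gpcompl M) : M := (repr g).1 + \sum_(h <- rem g L') (repr h).2.
have eE g : g \in L' -> gp_of (e g) = gp_of u + g.
  move=> gL; rewrite /u (big_rem g)//= /e !gp_ofD.
  have gE := gp_repr_sub g; move: gE.
  set c := gp_of (\sum_(h <- _) _); set p := gp_of _.1; set q := gp_of _.2.
  by move=> ->; rewrite addrAC [q + _]addrC subrK.
exists u, (u :: map e L'); split=> [|m|a b abB]; first exact: mem_head.
  rewrite inE => /predU1P[->|/mapP[g gL ->]].
    by rewrite subrr => i; rewrite mxE normr0.
  rewrite eE// raddfD addrC addKr => i.
  by move: gL; rewrite mem_filter => /andP[/forallP].
pose g := gp_of a - gp_of b.
have gL : g \in L'.
  have gB : sup_le (phi g) B by rewrite raddfB.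
  rewrite mem_filter hL// ?andbT; first exact/forallP.
  by apply: zspanD => //; exact: zspanN.
exists (e g); first by rewrite inE map_f ?orbT.
by apply/gp_of_eq; rewrite gp_ofD [RHS]gp_ofD eE// addrCA /g [gp_of b + _]addrC subrK addrC.
Qed.

End RankCoordinates.

(** * Markers, centers and the Schreier metric *)

Section Markers.
Variables (M : nmodType) (X : Type) (act : M -> X -> X).
Hypothesis actP : monoid_action act.
Variables (u : M) (E : seq M) (K : nat) (c : X -> 'I_K).

Lemma actD m n x : act (m + n) x = act m (act n x).
Proof. exact: actP.2. Qed.

Lemma actC m n x : act m (act n x) = act n (act m x).
Proof. by rewrite -!actD addrC. Qed.

(** [marker n x] means that the greedy algorithm, having treated the colors
    below n, has selected the position n u ahead of x.  At stage n + 1 this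
    position moves by u; the positions close to it, seen from x, are those at
    n u + m with m in E, which can be written although M has no inverses. *)
Fixpoint marker n : set X := if n is n'.+1 then
  [set x | marker n' (act u x) \/
    (c (act (u *+ n'.+1) x) = n' :> nat /\
     forall m, m \in E -> ~ marker n' (act m x))] else set0.

Lemma marker_shift n k x : marker n (act (u *+ k) x) -> marker (n + k) x.
Proof.
elim: k x => [|k IH] x; first by rewrite mulr0n actP.1 addn0.
by rewrite mulrSr actD => /IH h; rewrite addnS; left.
Qed.

(** The position (K + 1) u ahead of x either was selected when its color was
    treated, or a position close to it had been selected earlier. *)
Lemma marker_ahead x : u \in E -> exists2 m, m \in E & marker K (act m x).
Proof.
move=> uE; pose i := c (act (u *+ K.+1) x); have iK := ltn_ord i.
pose z := act (u *+ (K - i)) x.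
have [hz|hz] := pselect (forall m, m \in E -> ~ marker i (act m z)).
  exists u => //; rewrite -(subnKC iK); apply: marker_shift; rewrite -actD -mulrSr subnSK//.
  by right; split=> //; rewrite -actD -mulrnDr addSn subnKC// ltnW.
have [m mE hm] : exists2 m, m \in E & marker i (act m z).
  by apply: contrapT => h; apply: hz => m mE hm; apply: h; exists m.
exists m => //; rewrite -(subnKC (ltnW iK)); apply: marker_shift.
by rewrite actC.
Qed.

(** Recovers the stage i at which the position n u ahead of x was selected: at
    that stage nothing close to it had been selected. *)
Lemma marker_origin n x : marker n x -> exists i,
  [/\ (i < n)%N, c (act (u *+ n) x) = i :> nat,
      forall m, m \in E -> ~ marker i (act m (act (u *+ (n - i.+1)) x)) &
      forall j, (i < j <= n)%N -> marker j (act (u *+ (n - j)) x)].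
Proof.
elim: n x => [//|n IH] x hx; case: (hx) => [/IH[i [ni ci hi hj]]|[cn hn]].
  exists i; split=> [||m mE|j /andP[ij]].
  - exact: ltnW.
  - by rewrite mulrSr actD.
  - by rewrite subSn// mulrSr actD; exact: hi.
  - rewrite leq_eqVlt => /predU1P[->|jn]; first by rewrite subnn mulr0n actP.1.
    by rewrite subSn// mulrSr actD; apply: hj; rewrite ij.
exists n; split=> // [m mE|j]; first by rewrite subnn mulr0n actP.1; exact: hn.
by rewrite -eqn_leq => /eqP <-; rewrite subnn mulr0n actP.1.
Qed.

(** If two close positions are selected at different stages, the earlier one
    forbids the later one; if they are selected at the same stage, they have
    the same color, so the coloring makes them the same point. *)
Lemma marker_separated y y' m m' :
  (forall z z', (exists2 n, n \in E & act n z = act u z') -> z <> z' -> c z <> c z') ->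
  marker K y -> marker K y' -> m \in E -> m' \in E ->
  act m y = act u y' -> act m' y' = act u y ->
  act (u *+ K) y = act (u *+ K) y'.
Proof.
move=> hc hy hy' mE m'E my m'y'.
have [i [iK ci ni ji]] := marker_origin hy.
have [i' [iK' ci' ni' ji']] := marker_origin hy'.
have [ii'|i'i|ii'] := ltngtP i i'.
- have := ni' m' m'E; rewrite actC m'y' -actD -mulrSr subnSK// => F.
  by case: F; apply: ji; rewrite ii' ltnW.
- have := ni m mE; rewrite actC my -actD -mulrSr subnSK// => F.
  by case: F; apply: ji'; rewrite i'i ltnW.
- apply: contrapT => /(hc (act (u *+ K) y) (act (u *+ K) y')); apply.
    by exists m => //; rewrite actC my actC.
  by apply: val_inj; rewrite /= ci ci'.
Qed.

Definition offset x : M := nth 0 E (find (fun m => `[< marker K (act m x) >]) E).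

Definition center x : X := act (u *+ K) (act (offset x) x).

Lemma offsetP x : u \in E -> offset x \in E /\ marker K (act (offset x) x).
Proof.
move=> /(marker_ahead x)[m mE hm].
have hasE : has (fun m => `[< marker K (act m x) >]) E.
  by apply/hasP; exists m => //; exact/asboolP.
split; last exact/asboolP/(nth_find 0 hasE).
by apply: mem_nth; rewrite -has_find.
Qed.

End Markers.

Section MeasurableMarkers.
Variables (M : nmodType) (d : measure_display) (X : measurableType d).
Variable act : M -> X -> X.
Hypothesis actP : monoid_action act.
Hypothesis act_borel : borel_action act.
Variables (u : M) (E : seq M) (K : nat) (c : X -> 'I_K).
Hypothesis mc : forall v, measurable [set x | c x = v].

Lemma measurable_marker n : measurable (marker act u E c n).
Proof.
elim: n => [|n IH]; first exact: measurable0.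
apply: mpred_or; first exact: (mpred_comp (P := marker act u E c n) (act_borel u)).
apply: mpred_and; last first.
  apply: mpred_forall_in => m.
  apply: mpred_not; exact: (mpred_comp (P := marker act u E c n) (act_borel m)).
apply: (mpred_comp (P := fun y => c y = n :> nat) (act_borel _)).
rewrite (_ : mkset _ = [set x | exists v, c x = v /\ v = n :> nat]).
  apply: mpred_exists => v; apply: mpred_and; [exact: mc|exact: mpred_const].
by apply/seteqP; split=> x /= => [<-|[v [->]]]//; exists (c x).
Qed.

Lemma measurable_center : u \in E -> measurable_fun setT (center act u E c).
Proof.
move=> uE _ B mB; rewrite setTI.
pose P j x := marker act u E c K (act (nth 0 E j) x).
have mP j : measurable [set x | P j x].
  apply: (mpred_comp (P := marker act u E c K) (act_borel _)).
  exact: measurable_marker.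
rewrite (_ : _ @^-1` _ = [set x | exists j, (P j x /\
    forall i, (i < j)%N -> ~ P i x) /\ ((j < size E)%N /\
    B (act (u *+ K) (act (nth 0 E j) x)))]).
  apply: mpred_exists => j; apply: mpred_and; apply: mpred_and => //.
  - apply: mpred_forall => i; apply: mpred_imply; first exact: mpred_const.
    exact: mpred_not.
  - exact: mpred_const.
  - apply: (mpred_comp (P := fun y => B (act (u *+ K) y)) (act_borel _)).
    exact: (mpred_comp (P := B) (act_borel _)).
apply/seteqP; split=> x /=.
  have [oE om] := offsetP actP c x uE => Bx.
  exists (find (fun m => `[< marker act u E c K (act m x) >]) E).
  split; first split=> //.
    move=> i /(before_find 0) h Pi; move: h.
    by rewrite (asboolT Pi).
  split=> //; rewrite -has_find; apply/hasP.
  by exists (offset act u E c x) => //; exact/asboolP.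
move=> [j [[Pj nP] [jE]]]; rewrite /center /offset.
suff -> : find (fun m => `[< marker act u E c K (act m x) >]) E = j by [].
have hasE : has (fun m => `[< marker act u E c K (act m x) >]) E.
  by apply/hasP; exists (nth 0 E j); [exact: mem_nth|exact/asboolP].
apply/eqP; rewrite eqn_leq; apply/andP; split; rewrite leqNgt; apply/negP.
  by move=> /(before_find 0); rewrite (asboolT Pj).
by move=> /nP; apply; exact/asboolP/(nth_find 0 hasE).
Qed.

End MeasurableMarkers.

Lemma measurable_kernel (R : realType) (d : measure_display)
    (X : measurableType d) (h : X -> X) :
  standard_borel R X -> measurable_fun setT h ->
  measurable [set p : X * X | h p.1 = h p.2].
Proof.
move=> stdX mh; have [b [mb sb]] := separating_family stdX.
rewrite (_ : mkset _ = [set p : X * X | forall n, b n (h p.1) <-> b n (h p.2)]).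
  have mhb n : measurable [set x | b n (h x)] by exact: (mpred_comp (P := b n) mh (mb n)).
  apply: mpred_forall => n; apply: mpred_and; apply: mpred_imply;
    by [exact: (mpred_comp (P := fun x => b n (h x)) measurable_fst)|
        exact: (mpred_comp (P := fun x => b n (h x)) measurable_snd)].
apply/seteqP; split=> -[x y] /= => [->//|hb].
by apply: contrapT => /sb[n]; have := hb n; tauto.
Qed.

Section SchreierMetric.
Variables (R : realType) (M : nmodType) (S : seq M).
Variables (X : eqType) (act : M -> X -> X).
Hypothesis actP : monoid_action act.

Fixpoint words k : seq M :=
  if k is k'.+1 then words k' ++ [seq s + m | s <- S, m <- words k'] else [:: 0].

Lemma words_le k l m : (k <= l)%N -> m \in words k -> m \in words l.
Proof.
move=> /subnKC <-; elim: (l - k)%N => [|n IH] mk; rewrite ?addn0 ?addnS//=.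
by rewrite mem_cat IH.
Qed.

Lemma words_add s k m : s \in S -> m \in words k -> s + m \in words k.+1.
Proof. by move=> sS mk; rewrite /= mem_cat allpairs_f ?orbT. Qed.

Lemma generates_words : generates S -> forall F : seq M,
  exists k, {subset F <= words k}.
Proof.
move=> genS; elim=> [|m F [k hk]]; first by exists 0%N.
have [w wS ->] := genS m; exists (maxn k (size w)) => n.
rewrite inE => /predU1P[->|/hk nk]; last by apply: words_le nk; exact: leq_maxl.
apply: (@words_le (size w)); first exact: leq_maxr.
elim: w wS => [|s w IH] wS; first by rewrite big_nil inE.
rewrite big_cons; apply: words_add; first by apply: wS; exact: mem_head.
by apply: IH => t tw; apply: wS; rewrite inE tw orbT.
Qed.

(** Edges of the path are traversed in both directions, but the generators
    applied at either end commute with everything met so far. *)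
Lemma path_words x p : path (schreier S act) x p ->
  exists a b, [/\ a \in words (size p), b \in words (size p) &
    act a (last x p) = act b x].
Proof.
elim: p x => [|x1 p IH] x /=.
  by exists 0, 0; rewrite inE eqxx.
move=> /andP[/andP[_ /hasP[s sS xx1]] /IH[a [b [ak bk ab]]]].
case/orP: xx1 => /eqP xE.
  exists a, (s + b); split; [exact: (words_le (leqnSn _) ak)|exact: words_add|].
  by rewrite ab xE -(actD actP) addrC.
exists (s + a), b; split; [exact: words_add|exact: (words_le (leqnSn _) bk)|].
by rewrite (actD actP) ab xE (actC actP).
Qed.

Definition joined k x y :=
  exists p, [/\ path (schreier S act) x p, last x p = y & (size p <= k)%N].

Lemma joined_trans k l x y z : joined k x y -> joined l y z -> joined (k + l) x z.
Proof.
move=> [p [px py pk]] [q [qy qz ql]]; exists (p ++ q).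
by rewrite cat_path last_cat px py qy size_cat leq_add.
Qed.

Lemma joined_gen s x : s \in S -> joined 1 x (act s x) /\ joined 1 (act s x) x.
Proof.
move=> sS; have [xE|xs] := eqVneq x (act s x).
  by rewrite -xE; split; exists [::].
have e1 : schreier S act x (act s x).
  by rewrite /schreier /= xs; apply/hasP; exists s; rewrite ?eqxx.
have e2 : schreier S act (act s x) x.
  by rewrite /schreier /= eq_sym xs; apply/hasP; exists s; rewrite ?eqxx ?orbT.
by split; [exists [:: act s x]|exists [:: x]]; split; rewrite //= ?e1 ?e2.
Qed.

Lemma joined_word k m x : m \in words k ->
  joined k x (act m x) /\ joined k (act m x) x.
Proof.
elim: k m => [|k IH] m /=; first by rewrite inE => /eqP ->; rewrite actP.1; split; exists [::].
rewrite mem_cat => /orP[/IH[[p [? ? pk]] [q [? ? qk]]]|].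
  by split; [exists p|exists q]; split=> //; exact: leqW.
move=> /allpairsP[[s n] [/= sS /IH[h1 h2] ->]].
have [g1 g2] := joined_gen (act n x) sS.
rewrite (actD actP) -[k.+1]addn1; split; first exact: joined_trans h1 g1.
by rewrite addnC; exact: joined_trans g2 h2.
Qed.

(** Path lengths are integers, so a finite infimum is attained. *)
Lemma schreier_dist_le k x y :
  joined k x y <-> (schreier_dist R S act x y <= k%:R%:E)%E.
Proof.
split=> [[p [px py pk]]|xy].
  apply: le_trans (_ : ((size p)%:R%:E <= _)%E); last by rewrite lee_fin ler_nat.
  by apply: ereal_inf_lbound; exists p.
apply: contrapT => nj.
suff : (k.+1%:R%:E <= schreier_dist R S act x y)%E.
  by move=> /le_trans/(_ xy); rewrite lee_fin ler_nat ltnn.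
apply: le_ereal_inf_tmp => _ [p [px py] <-]; rewrite lee_fin ler_nat ltnNge.
by apply/negP => pk; apply: nj; exists p.
Qed.

End SchreierMetric.

(** * Counting classes *)

Section Counting.

(** Cuts [- 3w, 3w] into three intervals of length 2w. *)
Definition third (w t : rat) : 'I_3 :=
  if t < - w then ord0 else if t < w then inord 1 else ord_max.

Lemma third_close w t t' : `|t| <= 3 * w -> `|t'| <= 3 * w ->
  third w t = third w t' -> `|t - t'| <= 2 * w.
Proof.
rewrite !ler_norml => /andP[? ?] /andP[? ?] /(congr1 val); rewrite /third.
by case: (ltP t (- w)) => ?; case: (ltP t' (- w)) => ?;
  case: (ltP t w) => ?; case: (ltP t' w) => ?; rewrite /= ?inordK// => _;
  apply/andP; split; lra.
Qed.

Lemma card_le_ffun (T : Type) (I J : finType) (j0 : J) (A : set T)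
    (v : {ffun I -> J} -> T) :
  A `<=` v @` setT -> A #<= `I_(#|J| ^ #|I|).
Proof.
move=> Av; rewrite -card_ffun.
pose e i := v (nth [ffun=> j0] (enum {ffun I -> J}) i).
apply: card_le_trans (card_image_le e _).
apply: subset_card_le => x /Av[b _ <-].
exists (index b (enum {ffun I -> J})); last by rewrite /e nth_index ?mem_enum.
by rewrite /= cardE index_mem mem_enum.
Qed.

End Counting.

Lemma common_translation (M : nmodType) (T : eqType) (s : seq T)
    (P : T -> M -> Prop) :
  (forall t k l, P t k -> P t (k + l)) ->
  (forall t, t \in s -> exists k, P t k) ->
  exists k, forall t, t \in s -> P t k.
Proof.
move=> Pup; elim: s => [|t s IH] hs; first by exists 0.
have [|k hk] := IH; first by move=> t' t's; apply: hs; rewrite inE t's orbT.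
have [l hl] := hs t (mem_head _ _); exists (k + l) => t'.
rewrite inE => /predU1P[->|/hk/Pup]//.
by rewrite addrC; exact: Pup.
Qed.

Theorem corollary1p2 (R : realType) (M : nmodType) (S : seq M) (r : nat)
    (d : measure_display) (X : measurableType d) (act : M -> X -> X)
    (genS : generates S)
    (rankM : has_rank M r)
    (stdX : standard_borel R X)
    (actP : monoid_action act)
    (act_borel : borel_action act)
    (act_bounded : bounded_to_one act) :
  borel_asdim_le R S act ((3 ^ r.+1 - 3) %/ 2)%N.
Proof.
move=> s _; have [psi [psiD psi_nbhd]] := rank_coordinates genS rankM.
(* [cow m] complements the word m to p, so that applying p absorbs any path of
   length at most s; B collects the elements that this produces. *)
pose W := words S s; pose p : M := \sum_(m <- W) m.
pose cow (m : M) : M := \sum_(n <- rem m W) n.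
have cowE m : m \in W -> p = cow m + m by move=> mW; rewrite /p (big_rem m)//= addrC.
pose B := [seq cow a + b | a <- W, b <- W].
pose w : rat := \sum_(b <- B) norm1 (psi b).
have w_ge0 : 0 <= w by apply: sumr_ge0 => b _; exact: norm1_ge0.
have wB b : b \in B -> sup_le (psi b) w.
  move=> bB i; apply: le_trans (sup_le_norm1 _ i) _.
  by rewrite /w (big_rem b)//= lerDl sumr_ge0// => c _; exact: norm1_ge0.
have [|u [E [uE Ew Enbhd]]] := psi_nbhd (2 * w); first by rewrite mulr_ge0.
have [K [c [mc hc]]] : finitely_colorable (fun y z => exists2 m, m \in E & act m y = act u z).
  apply: finitely_colorable_seq => m; have [k hk] := act_bounded m.
  have [l hl] := act_bounded u.
  exact: (finitely_colorable_span stdX (act_borel m) (act_borel u) hk hl).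
pose G := [seq m + b | m <- E, b <- B].
(* Close coordinates give an equality in M^gp only; adding z makes it true in M
   for all of the finitely many pairs of elements of G. *)
have [z hz] : exists z, forall ab, ab \in [seq (a, b) | a <- G, b <- G] ->
    sup_le (psi ab.1 - psi ab.2) (2 * w) ->
    exists2 m, m \in E & ab.1 + u + z = ab.2 + m + z.
  apply: common_translation => [[a b] k l /= h /h[m mE e]|[a b] _ /=].
    by exists m => //; rewrite !addrA e.
  have [/Enbhd[m mE [k e]]|nab] := pselect (sup_le (psi a - psi b) (2 * w)).
    by exists k => _; exists m.
  by exists 0 => /nab.
pose q := z + p; pose h x := center act u E c (act q x).
have mh : measurable_fun setT h.
  by apply: measurableT_comp (measurable_center actP act_borel mc uE) (act_borel q).
exists (fun x y => h x == h y); split.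
- by move=> x y t; rewrite eqxx; split=> // /eqP ->.
- rewrite (_ : mkset _ = [set pr | h pr.1 = h pr.2]).
    exact: (measurable_kernel stdX mh).
  by apply/seteqP; split=> pr /= /eqP.
- have [D hD] := generates_words genS [seq u *+ K + (m + q) | m <- E].
  exists (D + D)%N => x y /eqP hxy; apply/schreier_dist_le.
  have hE t : exists2 m, m \in words S D & h t = act m t.
    have [oE _] := offsetP actP c (act q t) uE.
    exists (u *+ K + (offset act u E c (act q t) + q)); first exact/hD/map_f.
    by rewrite (actD actP) (actD actP).
  have [m mD hx] := hE x; have [n nD hy] := hE y.
  have [j1 _] := joined_word actP x mD; have [_ j2] := joined_word actP y nD.
  by apply: joined_trans j1 _; rewrite -hx hxy hy.
- move=> x; pose x1 := act z x.
  have ballE y : schreier_ball R S act x s y -> exists g,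
      [/\ g \in G, marker act u E c K (act g x1) & h y = act (u *+ K) (act g x1)].
    move=> /schreier_dist_le[path_xy [pxy lasty sizey]].
    have [a [b [aW bW ab]]] := path_words actP pxy; rewrite lasty in ab.
    have {}aW := words_le sizey aW; have {}bW := words_le sizey bW.
    have qy : act q y = act (cow a + b) x1.
      rewrite /q (cowE a aW) addrA !(actD actP) ab /x1.
      by rewrite -!(actD actP) -addrA [z + _]addrC.
    have [oE om] := offsetP actP c (act q y) uE.
    exists (offset act u E c (act q y) + (cow a + b)).
    rewrite (actD actP) -qy; split=> //.
    by apply: allpairs_f => //; exact: allpairs_f.
  pose bx g := [ffun i : 'I_r => third w ((psi g - psi u) 0 i)].
  have same g g' : g \in G -> g' \in G -> marker act u E c K (act g x1) ->
      marker act u E c K (act g' x1) -> bx g = bx g' ->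
      act (u *+ K) (act g x1) = act (u *+ K) (act g' x1).
    move=> gG g'G mg mg' bgg'.
    have far a : a \in G -> sup_le (psi a - psi u) (3 * w).
      move=> /allpairsP[[m b] [/= mE bB ->]]; rewrite psiD addrAC.
      rewrite (_ : 3 * w = 2 * w + w); last by ring.
      by apply: sup_leD; [exact: Ew|exact: wB].
    have close a b : a \in G -> b \in G -> bx a = bx b ->
        exists2 m, m \in E & act u (act a x1) = act m (act b x1).
      move=> aG bG ab; have ab_close : sup_le (psi a - psi b) (2 * w).
        move=> i; have := congr1 (fun f : {ffun 'I_r -> 'I_3} => f i) ab.
        rewrite !ffunE => /(third_close (far a aG i) (far b bG i)).
        by rewrite !mxE opprB addrA subrK.
      have [|m mE /= e] := hz (a, b) _ ab_close; first exact: allpairs_f.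
      exists m => //; rewrite /x1 -!(actD actP); congr (act _ x).
      by rewrite [u + a]addrC [m + b]addrC.
    have [m mE e] := close _ _ gG g'G bgg'.
    have [m' m'E e'] := close _ _ g'G gG (esym bgg').
    exact: (marker_separated actP hc mg mg' m'E mE (esym e') (esym e)).
  have /choice[v hv] : forall b, exists v, forall g, g \in G ->
      marker act u E c K (act g x1) -> bx g = b -> act (u *+ K) (act g x1) = v.
    move=> b; have [[g [gG mg <-]]|nb] := pselect (exists g,
        [/\ g \in G, marker act u E c K (act g x1) & bx g = b]).
      by exists (act (u *+ K) (act g x1)) => g' g'G mg' e; apply: same.
    by exists x => g gG mg e; case: nb; exists g.
  (* The class of y is determined by the small cube containing its marker. *)
  apply: (@card_le_trans _ _ _ `I_(3 ^ r)); last first.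
    by rewrite card_le_II expnS; have := expn_gt0 3 r; lia.
  have := @card_le_ffun _ 'I_r 'I_3 ord0 _ (fun b => [set t | v b == h t]).
  rewrite !card_ord; apply=> _ [y /ballE[g [gG mg hy]] <-].
  by exists (bx g) => //; rewrite -(hv _ g gG mg erefl) -hy.
Qed.
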